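(* Let $\beta_0,\beta_1,\beta_2$ be real numbers with $0<\beta_0<\beta_1<\beta_2$. Then for every $n\ge 2$, if $X^n(t)$ is the crystal growth process on $\{\mathbb{Z}_+\}^n$ with parameters $\beta_0,\beta_1,\beta_2$ and zero boundary conditions, the Markov process $(\Delta_1X^n(t),\ldots,\Delta_{n-1}X^n(t))$, $t\ge 0$, is positive recurrent and its unique invariant measure has exponentially decaying tails.
   Context: $\mathbb{Z}_+=\{0,1,2,\ldots\}$. Define $$r(a,b,c)=\begin{cases}\beta_2,&\text{if } b<\min\{a,c\},\\ \beta_1,&\text{if }\min\{a,c\}\le b<\max\{a,c\},\\ \beta_0,&\text{if }\max\{a,c\}\le b.\end{cases}$$ For $n\ge2$, the crystal growth process with zero boundary conditions is the continuous-time Markov jump process $X^n(t)=(X^n_1(t),\ldots,X^n_n(t))$ on $\{\mathbb{Z}_+\}^n$ in which, for each $1\le i\le n$, the coordinate $X_i^n(t)$ increases by $1$ at rate $r(X^n_{i-1}(t),X^n_i(t),X^n_{i+1}(t))$, where by convention $X^n_0(t)=X^n_{n+1}(t)=0$ for all $t\ge0$. For $1\le i\le n-1$ put $\Delta_iX^n(t)=X^n_i(t)-X^n_{i+1}(t)$. The rates depend only on these differences (all coordinates being nonnegative), so $(\Delta_1X^n(t),\ldots,\Delta_{n-1}X^n(t))$ is itself a Markov jump process, with state space $\mathbb{Z}^{n-1}$. ''Invariant measure'' means invariant probability measure. An invariant measure $\pi$ has exponentially decaying tails if there exist constants $C,\alpha>0$ such that $\pi(\{z:|z_i|\ge k\})\le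 Ce^{-\alpha k}$ for all $k\in\mathbb{N}$ and all coordinates $i$. *)

(* Defs.v *)
From HB Require Import structures.
From mathcomp Require Import all_boot all_order all_algebra.
From mathcomp Require Import all_classical all_reals all_analysis.

Set Implicit Arguments.
Unset Strict Implicit.
Unset Printing Implicit Defensive.

Import Order.TTheory GRing.Theory Num.Theory.
Import numFieldTopology.Exports numFieldNormedType.Exports.

Local Open Scope classical_set_scope.
Local Open Scope ring_scope.

(** * Continuous-time Markov chains on a countable state space [S].
    Time is [R]; only nonnegative times are constrained. *)

Section MarkovJumpProcess.
Context {R : realType} {S : countType}.
Implicit Types (q : S -> S -> R) (p : R -> S -> S -> R).

Definition transition_function p : Prop :=
  [/\ forall t x y, 0 <= t -> 0 <= p t x y,
      forall t x, 0 <= t -> \esum_(y in [set: S]) (p t x y)%:E = 1%E,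
      forall x y, p 0 x y = (x == y)%:R
    & forall s t x y, 0 <= s -> 0 <= t ->
        (p (s + t) x y)%:E = \esum_(z in [set: S]) (p s x z * p t z y)%:E].

(* Only the off-diagonal values of a rate function [q] are ever used. *)
Definition exit_rate q (x : S) : R :=
  fine (\esum_(y in [set y | y != x]) (q x y)%:E).

(* "Jumps from [x] to [y] occur at rate [q x y]":
   [p h x y = q x y * h + o(h)] for [y != x] and
   [p h x x = 1 - exit_rate q x * h + o(h)], as [h] decreases to [0]. *)
Definition has_rates p q : Prop :=
  (forall x y, x != y -> p h x y / h @[h --> 0^'+] --> q x y) /\
  (forall x, (p h x x - 1) / h @[h --> 0^'+] --> - exit_rate q x).

Context {d : measure_display} {T : measurableType d}.

(* [past] is a finite list of (time, state) constraints up to time [s]. *)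
Definition markov_property p (P : probability T R) (X : R -> T -> S) : Prop :=
  forall (past : seq (R * S)) (s t : R) (x y : S),
    0 <= s -> 0 <= t -> all (fun u => 0 <= u.1 <= s) past ->
    let E := [set w | all (fun u => X u.1 w == u.2) past] `&`
             [set w | X s w = x] in
    P (E `&` [set w | X (s + t) w = y]) = (P E * (p t x y)%:E)%E.

(* The initial law of [X] is arbitrary.  Right continuity is with respect to
   the discrete topology of [S]. *)
Definition markov_jump_process q (P : probability T R) (X : R -> T -> S)
    : Prop :=
  [/\ forall t x, 0 <= t -> measurable [set w | X t w = x],
      forall w t, 0 <= t -> \forall s \near t^'+, X s w = X t w
    & exists p, [/\ transition_function p, has_rates p q
                  & markov_property p P X]].

(* First time at which the path leaves its initial state. *)
Definition first_jump_time (Y : R -> T -> S) (w : T) : \bar R :=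
  ereal_inf [set t%:E | t in [set t : R | 0 <= t /\ Y t w <> Y 0 w]].

Definition return_time (Y : R -> T -> S) (z : S) (w : T) : \bar R :=
  ereal_inf [set t%:E | t in [set t : R |
    [/\ 0 <= t, (first_jump_time Y w <= t%:E)%E & Y t w = z]]].

(* In what follows [P z] is the law under which the process starts at [z]. *)

Definition positive_recurrent (P : S -> probability T R) (Y : R -> T -> S)
    : Prop :=
  forall z, (\int[P z]_w return_time Y z w < +oo)%E.

(* Probability measures on [S] are given by their mass functions. *)
Definition invariant_probability (P : S -> probability T R) (Y : R -> T -> S)
    (mu : S -> R) : Prop :=
  [/\ forall z, 0 <= mu z,
      \esum_(z in [set: S]) (mu z)%:E = 1%E
    & forall t y, 0 <= t ->
        \esum_(z in [set: S]) ((mu z)%:E * P z [set w | Y t w = y])%E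
        = (mu y)%:E].

End MarkovJumpProcess.

(** * The crystal growth process *)

Section CrystalGrowth.
Context {R : realType}.
Variables beta0 beta1 beta2 : R.

Definition growth_rate (a b c : nat) : R :=
  if (b < minn a c)%N then beta2
  else if (b < maxn a c)%N then beta1
  else beta0.

Definition config (n : nat) : countType := {ffun 'I_n -> nat}.

(* Sites are numbered from 1 to [n] in [height], with zero boundary conditions
   at sites 0 and [n.+1]; the index [i : 'I_n] stands for site [i.+1]. *)
Definition height n (x : config n) (k : nat) : nat :=
  if k is k'.+1 then oapp x 0%N (insub k' : option 'I_n) else 0%N.

Definition grow n (x : config n) (i : 'I_n) : config n :=
  [ffun j => (x j + (j == i))%N].

Definition crystal_rate n (x y : config n) : R :=
  \sum_(i < n | y == grow x i)
    growth_rate (height x i) (height x i.+1) (height x i.+2).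

Definition crystal_growth_process n {d : measure_display}
    {T : measurableType d} (P : probability T R) (X : R -> T -> config n)
    : Prop :=
  markov_jump_process (@crystal_rate n) P X.

End CrystalGrowth.

Definition diffs (n : nat) : countType := {ffun 'I_n.-1 -> int}.

Definition Delta n (x : config n) : diffs n :=
  [ffun i : 'I_n.-1 => (height x i.+1)%:Z - (height x i.+2)%:Z].

Definition exponential_tails {R : realType} n (mu : diffs n -> R) : Prop :=
  exists C alpha : R, [/\ 0 < C, 0 < alpha &
    forall (k : nat) (i : 'I_n.-1),
      (\esum_(z in [set z : diffs n | (k <= `|z i|)%N]) (mu z)%:E
       <= (C * expR (- (alpha * k%:R)))%:E)%E].

(* Main.v *)
Require Import Defs.
From HB Require Import structures.
From mathcomp Require Import all_boot all_order all_algebra.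
From mathcomp Require Import all_classical all_reals all_analysis.
From mathcomp Require Import measurable_realfun.
From mathcomp Require Import ring lra zify.

Set Implicit Arguments.
Unset Strict Implicit.
Unset Printing Implicit Defensive.

Import Order.TTheory GRing.Theory Num.Theory.
Import numFieldTopology.Exports numFieldNormedType.Exports.

Local Open Scope classical_set_scope.
Local Open Scope ring_scope.

(** For a set [I] of sites, take the average of the heights over [I] with
    weights decaying geometrically from left to right.  If no site adjacent to
    [I] is higher than its neighbour in [I], this average grows at rate less
    than [beta1 - eps]: the first site of [I] that is not lower than its right
    neighbour grows at rate [beta0] only.  On the other hand a site with a higher
    neighbour grows at rate at least [beta1].  A sum of exponentials of
    (average over [I]) - (height at [j]), suitably weighted over [I] and [j], is
    then a Lyapunov function [V] with [Q V <= - delta V + C].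

    The jump rates are bounded, so the transition function is the limit of the
    Euler scheme [(1 + (t/m) Q)^m]; hence it depends on the differences only, and
    [V] contracts along the process observed at integer times.  This skeleton
    is a chain with positive kernel; killing it at a state [z] makes a shift of
    [V] contract geometrically, which bounds the return times, and the
    expected occupation of an excursion from [z] gives the invariant measure
    together with its exponential moments. *)

(** * Sums of nonnegative families *)

(** No fixed pair of sites can be controlled by itself: a high site may have a higher neighbour and
    grow faster than [beta0], while a low site without a higher neighbour grows only at [beta0].
    Hence the sum runs over all triples [(I, m, j)] with [m] in [I]. A triple is good when no site
    next to [I] is higher than its neighbour in [I] and [j] has a strictly higher neighbour; its
    exponent then drifts down. The exponents are adjusted so that any other triple either has a
    bounded exponent or is dominated by a triple whose exponent is larger by at least [A]. Its term
    is then at most [expR (- (theta * A))] times the whole sum, and for large [A] even a crude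
    growth bound is harmless. A second obstacle is that every initial law brings its own transition
    function, known only through its derivatives at time 0. These derivatives have to be shown to
    determine it before one kernel on differences can serve all initial states. *)

Section Esum.
Context {R : realType}.
Local Open Scope ereal_scope.

Lemma esum_ge_term (T : choiceType) (A : set T) (f : T -> \bar R) (x : T) :
  A x -> (forall i, 0 <= f i) -> f x <= \esum_(i in A) f i.
Proof.
move=> Ax f0; apply: esum_ge; exists [set x]; last by rewrite fsbig_set1.
by split => // y ->.
Qed.

Let esumZl_le (T : choiceType) (A : set T) (c : R) (f : T -> \bar R) :
  (0 <= c)%R -> (forall i, 0 <= f i) ->
  \esum_(i in A) (c%:E * f i) <= c%:E * \esum_(i in A) f i.
Proof.
move=> c0 f0; apply: ge_ereal_sup => /= _ [X [finX XA] <-].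
rewrite -ge0_mule_fsumr// lee_wpmul2l ?lee_fin//.
by apply: ereal_sup_ubound; exists X.
Qed.

Lemma esumZl (T : choiceType) (A : set T) (c : \bar R) (f : T -> \bar R) :
  0 <= c -> (forall i, 0 <= f i) ->
  \esum_(i in A) (c * f i) = c * \esum_(i in A) f i.
Proof.
case: c => [c| |]// c0 f0.
  move: c0; rewrite lee_fin le_eqVlt => /predU1P[<-|c0].
    by rewrite mul0e esum1// => i _; rewrite mul0e.
  apply/eqP; rewrite eq_le; apply/andP; split; first exact: esumZl_le (ltW c0) f0.
  (* The reverse inequality is the same one, applied with the constant [c^-1]. *)
  rewrite -lee_pdivlMl// (le_trans _ (esumZl_le _ _ _))//.
  - by apply: le_esum => i _; rewrite muleA -EFinM mulVf ?mul1e// gt_eqF.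
  - by rewrite invr_ge0 ltW.
  - by move=> i; rewrite mule_ge0// lee_fin ltW.
have := esum_ge0 (S := A) (fun i _ => f0 i); rewrite le_eqVlt => /predU1P[f1|f1].
  rewrite -f1 mule0 esum1// => i Ai.
  by rewrite (_ : f i = 0) ?mule0//; apply/le_anti; rewrite f0 [leRHS]f1 esum_ge_term.
rewrite gt0_mulye//.
have [i Ai fi0] : exists2 i, A i & 0 < f i.
  apply/not_exists2P => H; move: f1; rewrite esum1 ?ltxx// => i Ai.
  apply/le_anti; rewrite f0 andbT leNgt; apply/negP.
  by have [] := H i.
apply/eqP; rewrite -leye_eq -[leLHS](gt0_mulye fi0).
apply: (@esum_ge_term _ _ (fun i => +oo * f i)) => // j.
by rewrite mule_ge0.
Qed.

Lemma esum_exchange (T1 T2 : choiceType) (A : set T1) (B : set T2)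
    (f : T1 -> T2 -> \bar R) : (forall i j, 0 <= f i j) ->
  \esum_(i in A) \esum_(j in B) f i j = \esum_(j in B) \esum_(i in A) f i j.
Proof.
move=> f0; rewrite (@esum_esum _ _ _ A (fun=> B))// (@esum_esum _ _ _ B (fun=> A))//.
rewrite (reindex_esum (B `*` A) _ (fun x => (x.2, x.1)))//; split => //=.
- by move=> [i j] [/=].
- by move=> [i1 i2] [j1 j2] /= _ _ [] -> ->.
- by move=> [i1 i2] [Pi1 Qi2] /=; exists (i2, i1).
Qed.

Lemma le_esum_set (T : choiceType) (A B : set T) (f : T -> \bar R) :
  A `<=` B -> \esum_(i in A) f i <= \esum_(i in B) f i.
Proof.
move=> AB; apply: ge_ereal_sup => /= _ [X [finX XA] <-].
by apply: ereal_sup_ubound; exists X => //; split => // x /XA/AB.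
Qed.

Lemma esum_split_seq (T : choiceType) (s : seq T) (f : T -> \bar R) :
  uniq s -> (forall i, 0 <= f i) ->
  \esum_(i in setT) f i =
  \sum_(i <- s) f i + \esum_(i in [set i | i \notin s]) f i.
Proof.
move=> us f0; rewrite (esumID [set` s])//; congr (_ + _).
  rewrite setTI esum_fset//.
  by rewrite -fsbig_seq.
by rewrite setTI; congr esum; apply/seteqP; split=> i /= /negP.
Qed.

Lemma esum_fibers (T U : choiceType) (h : T -> U) (f : T -> \bar R) :
  (forall i, 0 <= f i) ->
  \esum_(x in setT) f x = \esum_(u in setT) \esum_(x in [set x | h x = u]) f x.
Proof.
move=> f0; rewrite esum_esum//.
rewrite (reindex_esum setT _ (fun x => (h x, x)))//; split => //=.
- by move=> x y _ _ [].
- by move=> [u x] [_ /= hx]; exists x => //; rewrite hx.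
Qed.

(** Change of variables: the inner sum over a fibre is the mass function of the image under [h].
    With [Delta] for [h], it turns sums over configurations into sums over differences. *)
Lemma esum_unfiber (T U : choiceType) (h : T -> U) (f : T -> \bar R)
    (g : U -> \bar R) :
  (forall i, 0 <= f i) -> (forall u, 0 <= g u) ->
  \esum_(x in setT) (f x * g (h x)) =
  \esum_(u in setT) ((\esum_(x in [set x | h x = u]) f x) * g u).
Proof.
move=> f0 g0; rewrite (esum_fibers h); last by move=> i; rewrite mule_ge0.
apply: eq_esum => u _; rewrite muleC -esumZl//.
by apply: eq_esum => x /= ->; rewrite muleC.
Qed.

Lemma probability_esum d (T : measurableType d) (P : {measure set T -> \bar R})
    (S : countType) (F : S -> set T) :
  (forall x, measurable (F x)) -> (forall x y w, F x w -> F y w -> x = y) ->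
  P (\bigcup_x F x) = \esum_(x in setT) P (F x).
Proof.
move=> mF dF.
pose G n := if @pickle_inv S n is Some x then F x else set0.
have -> : \bigcup_x F x = \bigcup_(n in range (@pickle S)) G n.
  apply/seteqP; split=> w [].
    by move=> x _ Fx; exists (pickle x); [exists x|rewrite /G pickleK_inv].
  by move=> _ [x _ <-]; rewrite /G pickleK_inv => Fx; exists x.
have mG n : measurable (G n) by rewrite /G; case: pickle_inv.
rewrite measure_bigcup//; last first.
  move=> _ _ [x _ <-] [y _ <-] [w []]; rewrite /G !pickleK_inv => Fx Fy.
  by rewrite (dF _ _ _ Fx Fy).
rewrite nneseries_esum//.
rewrite (_ : [set n | n \in _] = range (@pickle S)); last first.
  by apply/seteqP; split => n /=; rewrite inE.
rewrite esum_image; last by move=> x y _ _; exact: (pcan_inj (@pickleK S)).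
by apply: eq_esum => x _; rewrite /G pickleK_inv.
Qed.

Lemma esum_nat_le (f : nat -> \bar R) (c : \bar R) : (forall j, 0 <= f j) ->
  (forall n, \sum_(j < n) f j <= c) -> \esum_(j in setT) f j <= c.
Proof.
move=> f0 fc; rewrite -nneseries_esumT//.
apply: lime_le; first exact: is_cvg_nneseries.
by apply: nearW => n; rewrite big_mkord.
Qed.

Lemma esum_natS (f : nat -> \bar R) : (forall j, 0 <= f j) ->
  \esum_(j in setT) f j = f 0%N + \esum_(j in setT) f j.+1.
Proof.
move=> f0; rewrite (@esum_split_seq _ [:: 0%N])// big_seq1; congr (_ + _).
rewrite -(@esum_image _ _ _ setT S f); last by move=> i j _ _ [].
congr esum; apply/seteqP; split=> j /=; last by case=> i _ <-.
by rewrite inE; case: j => // j _; exists j.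
Qed.

Lemma esum_geometric_le (r c : R) : (0 <= r)%R -> (r < 1)%R -> (0 <= c)%R ->
  \esum_(j in [set: nat]) (r ^+ j * c)%:E <= (c / (1 - r))%:E.
Proof.
move=> r0 r1 c0; apply: esum_nat_le => [j|n].
  by rewrite lee_fin mulr_ge0// exprn_ge0.
rewrite sumEFin lee_fin -mulr_suml mulrC ler_wpM2l//.
have r10 : (0 < 1 - r)%R by rewrite subr_gt0.
rewrite -[leRHS]mul1r ler_pdivlMr// mulrC -opprB mulNr -subrX1 opprB.
by rewrite gerBl exprn_ge0.
Qed.

(** The nonnegative difference [g - f] has zero total mass; finiteness of the mass of [f] permits
    the cancellation. *)
Lemma esum_eq_le (T : choiceType) (f g : T -> R) :
  (forall x, (0 <= f x)%R) -> (forall x, (f x <= g x)%R) ->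
  \esum_(x in [set: T]) (g x)%:E <= \esum_(x in [set: T]) (f x)%:E ->
  \esum_(x in [set: T]) (f x)%:E < +oo ->
  f = g.
Proof.
move=> f0 fg gf foo; apply/funext => x; apply/eqP; rewrite eq_le fg/= -subr_le0.
have E : \esum_(x in [set: T]) (g x)%:E = \esum_(x in [set: T]) (f x)%:E +
    \esum_(x in [set: T]) (g x - f x)%:E.
  rewrite -esumD; last 2 first.
  - by move=> y _; rewrite lee_fin.
  - by move=> y _; rewrite lee_fin subr_ge0.
  by apply: eq_esum => y _; rewrite -EFinD addrC subrK.
have ffin : \esum_(x in [set: T]) (f x)%:E \is a fin_num.
  by rewrite ge0_fin_numE// esum_ge0// => y _; rewrite lee_fin.
rewrite -lee_fin; apply: (@le_trans _ _ (\esum_(x in [set: T]) (g x - f x)%:E)).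
  apply: (@esum_ge_term _ _ (fun x => (g x - f x)%:E)) => // y.
  by rewrite lee_fin subr_ge0.
by move: gf; rewrite E -[leRHS]adde0 leeD2lE.
Qed.

End Esum.

(** * The Euler scheme for bounded jump rates *)

(** Test functions with values in [0, 1] have finite expectations under a transition function, so
    [fine] in [expect] discards nothing. *)
Definition unit_valued {R : realType} {S : Type} (f : S -> R) : Prop :=
  forall x, 0 <= f x <= 1.

Definition expect {R : realType} {S : countType} (k : S -> S -> R) (f : S -> R)
    (x : S) : R :=
  fine (\esum_(y in [set: S]) (k x y * f y)%:E).

Section TransitionFunction.
Context {R : realType} {S : countType} {p : R -> S -> S -> R}.
Hypothesis tf : transition_function p.

Let p_ge0 t x y : 0 <= t -> 0 <= p t x y.
Proof. by case: tf => + _ _ _; exact. Qed.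

Let p_sum1 t x : 0 <= t -> \esum_(y in [set: S]) (p t x y)%:E = 1%E.
Proof. by case: tf => _ + _ _; exact. Qed.

Lemma expectE t f x : 0 <= t -> unit_valued f ->
  (expect (p t) f x)%:E = \esum_(y in [set: S]) (p t x y * f y)%:E.
Proof.
move=> t0 uf; rewrite /expect fineK// ge0_fin_numE; last first.
  apply: esum_ge0 => y _; rewrite lee_fin mulr_ge0 ?p_ge0//.
  by case/andP: (uf y).
apply: (@le_lt_trans _ _ 1%E); last by rewrite ltry.
rewrite -(p_sum1 x t0); apply: le_esum => y _; rewrite lee_fin.
by case/andP: (uf y) => ? ?; rewrite ler_piMr// p_ge0.
Qed.

Lemma expect_unit_valued t f : 0 <= t -> unit_valued f ->
  unit_valued (expect (p t) f).
Proof.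
move=> t0 uf x; rewrite -!lee_fin expectE//; apply/andP; split.
  apply: esum_ge0 => y _; rewrite lee_fin mulr_ge0 ?p_ge0//.
  by case/andP: (uf y).
rewrite -(p_sum1 x t0); apply: le_esum => y _; rewrite lee_fin.
by case/andP: (uf y) => ? ?; rewrite ler_piMr// p_ge0.
Qed.

Lemma expect0 f x : unit_valued f -> expect (p 0) f x = f x.
Proof.
move=> uf; have f0 y : 0 <= f y by case/andP: (uf y).
apply: EFin_inj; rewrite expectE//.
have -> : \esum_(y in [set: S]) (p 0 x y * f y)%:E =
    \esum_(y in [set: S]) if y \in [set x] then (f y)%:E else 0%E.
  apply: eq_esum => y _; case: tf => _ _ -> _.
  have [->|yx] := eqVneq y x; first by rewrite ?eqxx mul1r mem_set.
  by rewrite mul0r memNset// => /eqP; rewrite (negbTE yx).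
rewrite -esum_mkcond esum_set1//; by rewrite lee_fin.
Qed.

Lemma expectD s t f x : 0 <= s -> 0 <= t -> unit_valued f ->
  expect (p (s + t)) f x = expect (p s) (expect (p t) f) x.
Proof.
move=> s0 t0 uf; have f0 y : 0 <= f y by case/andP: (uf y).
apply: EFin_inj; rewrite !expectE ?addr_ge0//; last exact: expect_unit_valued.
have p0 := p_ge0.
transitivity (\esum_(y in [set: S]) \esum_(z in [set: S])
    (p s x z * p t z y * f y)%:E).
  apply: eq_esum => y _; rewrite mulrC EFinM; case: tf => _ _ _ ->//.
  rewrite -esumZl ?lee_fin//; last by move=> z; rewrite lee_fin mulr_ge0 ?p0.
  by apply: eq_esum => z _; rewrite -EFinM mulrC.
rewrite esum_exchange; last by move=> y z; rewrite lee_fin !mulr_ge0 ?p0.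
apply: eq_esum => z _; rewrite EFinM expectE// -esumZl ?lee_fin ?p0//; last first.
  by move=> y; rewrite lee_fin mulr_ge0 ?p0.
by apply: eq_esum => y _; rewrite -EFinM mulrA.
Qed.

End TransitionFunction.

Lemma near_at_right0 {R : realType} (Q : R -> Prop) :
  (\forall h \near 0^'+, Q h) ->
  exists2 h0, 0 < h0 & forall h, 0 < h -> h < h0 -> Q h.
Proof.
move=> [e /= e0 eQ]; exists e => // h h0 he; apply: eQ => //=.
by rewrite sub0r normrN gtr0_norm.
Qed.

(* Telescoping over [m] equal steps: what matters is that the [o(h)] errors are
   uniform along [0, t], so no differentiability of [u] is needed. *)
Lemma increment_bound {R : realType} (u : R -> R) (c K t : R) : 0 <= t ->
  (forall e, 0 < e -> exists2 h0, 0 < h0 & forall h s, 0 < h -> h < h0 ->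
     0 <= s -> s <= t -> `|u (s + h) - u s - c * h| <= (K + e) * h) ->
  `|u t - u 0 - c * t| <= K * t.
Proof.
rewrite le_eqVlt => /predU1P[<- _|t0 H].
  by rewrite !mulr0 subr0 subrr normr0.
apply/ler_addgt0Pr => e e0.
have et0 : 0 < e / t by rewrite divr_gt0.
have [h0 h00 Hh] := H _ et0.
have [m mh] : exists m : nat, t / h0 < m.+1%:R.
  exists (Num.bound (t / h0)); rewrite (lt_le_trans (archi_boundP _))//.
    by rewrite divr_ge0 ?ltW.
  by rewrite ler_nat.
pose h := t / m.+1%:R.
have hpos : 0 < h by rewrite divr_gt0.
have hlt : h < h0 by rewrite /h ltr_pdivrMr// mulrC -ltr_pdivrMr.
have step (k : nat) : (k <= m.+1)%N ->
    `|u (k%:R * h) - u 0 - c * (k%:R * h)| <= (K + e / t) * (k%:R * h).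
  elim: k => [|k IH] km; first by rewrite !mul0r subrr !mulr0 subr0 normr0.
  have kht : k%:R * h <= t.
    rewrite /h mulrCA ler_piMr ?(ltW t0)// ler_pdivrMr// mul1r ler_nat.
    exact: ltnW.
  have kh0 : 0 <= k%:R * h by rewrite mulr_ge0// ltW.
  have H1 := Hh h (k%:R * h) hpos hlt kh0 kht.
  have H2 := IH (ltnW km).
  rewrite -natr1 mulrDl mul1r.
  have -> : u (k%:R * h + h) - u 0 - c * (k%:R * h + h) =
    (u (k%:R * h + h) - u (k%:R * h) - c * h) +
    (u (k%:R * h) - u 0 - c * (k%:R * h)) by ring.
  by rewrite (le_trans (ler_normD _ _))// mulrDr addrC lerD.
have := step m.+1 (leqnn _).
rewrite (_ : m.+1%:R * h = t); last by rewrite /h mulrCA divff ?mulr1// pnatr_eq0.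
by rewrite mulrDl divfK// gt_eqF.
Qed.

Section EulerScheme.
Context {R : realType} {S : countType} {I : finType}.
Variables (jump : S -> I -> S) (rate : S -> I -> R) (lam : R).
Hypothesis rate_ge0 : forall x i, 0 <= rate x i.
Hypothesis rate_le : forall x, \sum_i rate x i <= lam.

Definition generator (f : S -> R) (x : S) : R :=
  \sum_i rate x i * (f (jump x i) - f x).

Definition euler (h : R) (f : S -> R) (x : S) : R := f x + h * generator f x.

Let lam_ge0 (x : S) : 0 <= lam.
Proof. by rewrite (le_trans _ (rate_le x))// sumr_ge0. Qed.

Lemma generatorB f g x :
  generator f x - generator g x = generator (fun y => f y - g y) x.
Proof.
rewrite /generator -sumrB; apply: eq_bigr => i _; rewrite -mulrBr; congr (_ * _).
ring.
Qed.

Lemma generator_bound f c x : (forall y z, `|f y - f z| <= c) ->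
  `|generator f x| <= lam * c.
Proof.
move=> fc; have c0 : 0 <= c by rewrite (le_trans _ (fc x x))//.
rewrite (le_trans (ler_norm_sum _ _ _))// (@le_trans _ _ (\sum_i rate x i * c))//.
  by apply: ler_sum => i _; rewrite normrM ger0_norm// ler_wpM2l.
by rewrite -mulr_suml ler_wpM2r.
Qed.

(** For [h * lam <= 1] a step replaces [f x] by a convex combination of [f x] and the values of [f]
    after one jump. *)
Lemma le_euler h f g : 0 <= h -> h * lam <= 1 -> (forall x, f x <= g x) ->
  forall x, euler h f x <= euler h g x.
Proof.
move=> h0 hl fg x; rewrite /euler /generator.
have E k : k x + h * (\sum_i rate x i * (k (jump x i) - k x)) =
  (1 - h * \sum_i rate x i) * k x + h * \sum_i rate x i * k (jump x i).
  under eq_bigr do rewrite mulrBr.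
  rewrite sumrB -mulr_suml; ring.
rewrite !E lerD// ?ler_wpM2l//.
- by rewrite subr_ge0 (le_trans _ hl)// ler_wpM2l.
- by apply: ler_sum => i _; rewrite ler_wpM2l.
Qed.

Lemma euler_affine h c d f x :
  euler h (fun y => c * f y + d) x = c * euler h f x + d.
Proof.
rewrite /euler /generator.
have -> : \sum_i rate x i * (c * f (jump x i) + d - (c * f x + d)) =
    c * \sum_i rate x i * (f (jump x i) - f x).
  by rewrite mulr_sumr; apply: eq_bigr => i _; ring.
ring.
Qed.

Lemma eulerB h f g x : euler h f x - euler h g x = euler h (fun y => f y - g y) x.
Proof. by rewrite /euler -generatorB; ring. Qed.

Lemma euler_cst h c x : euler h (fun=> c) x = c.
Proof. by rewrite /euler /generator big1 ?mulr0 ?addr0// => i _; rewrite subrr mulr0. Qed.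

Lemma euler_dist h f g c : 0 <= h -> h * lam <= 1 ->
  (forall x, `|f x - g x| <= c) -> forall x, `|euler h f x - euler h g x| <= c.
Proof.
move=> h0 hl fg x; rewrite eulerB ler_norml; apply/andP; split.
  rewrite -(euler_cst h (- c) x); apply: le_euler => // y.
  by have := fg y; rewrite ler_norml => /andP[].
rewrite -[leRHS](euler_cst h c x); apply: le_euler => // y.
by have := fg y; rewrite ler_norml => /andP[].
Qed.

Variable p : R -> S -> S -> R.
Hypothesis tf : transition_function p.

(** Uniform in the test function but not in the state: along the semigroup the state [x] stays fixed
    while the test function [expect (p s) g] varies with [s]. *)
Definition local_rates : Prop := forall (x : S) (e : R), 0 < e ->
  exists2 h0, 0 < h0 & forall h, 0 < h -> h < h0 -> forall g, unit_valued g ->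
    `|expect (p h) g x - euler h g x| <= e * h.
Hypothesis loc : local_rates.

Let unit_dist (g : S -> R) : unit_valued g -> forall y z, `|g y - g z| <= 1.
Proof.
move=> ug y z; have /andP[? ?] := ug y; have /andP[? ?] := ug z.
rewrite ler_norml; lra.
Qed.

(** The short time is put first in [p (h + s)], so the increment is a short-time expectation at the
    fixed state [x], and [local_rates] applies with one [h0] for all [s]. *)
Lemma expect_lipschitz t g x : 0 <= t -> unit_valued g ->
  `|expect (p t) g x - g x| <= lam * t.
Proof.
move=> t0 ug.
suff : `|expect (p t) g x - expect (p 0) g x - 0 * t| <= lam * t.
  by rewrite mul0r subr0 expect0.
apply: (increment_bound (u := fun t => expect (p t) g x)) => // e e0.
have [h0 h00 H] := loc x e0; exists h0 => // h s hp hh s0 st.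
have us := expect_unit_valued tf s0 ug.
rewrite mul0r subr0 [s + h]addrC (expectD tf)// ?(ltW hp)//.
have := H h hp hh _ us; rewrite /euler => H1.
have -> : expect (p h) (expect (p s) g) x - expect (p s) g x =
  (expect (p h) (expect (p s) g) x - (expect (p s) g x + h * generator (expect (p s) g) x))
  + h * generator (expect (p s) g) x by ring.
rewrite (le_trans (ler_normD _ _))// mulrDl addrC lerD//.
rewrite normrM gtr0_norm// mulrC ler_wpM2r ?(ltW hp)//.
by rewrite (le_trans (generator_bound _ (unit_dist us)))// mulr1.
Qed.

(** Up to the local error, the increment over [[s, s + h]] is [h] times the generator of
    [expect (p s) g]. By the Lipschitz bound that generator differs from the one of [g] by at most
    [lam * (2 * (lam * t))]. *)
Lemma expect_euler1 t g x : 0 <= t -> unit_valued g ->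
  `|expect (p t) g x - euler t g x| <= 2 * lam ^+ 2 * t ^+ 2.
Proof.
move=> t0 ug; suff : `|expect (p t) g x - expect (p 0) g x - generator g x * t|
    <= (2 * lam ^+ 2 * t) * t.
  by rewrite expect0// /euler opprD addrA (mulrC t) -mulrA.
apply: (increment_bound (u := fun t => expect (p t) g x)) => // e e0.
have [h0 h00 H] := loc x e0; exists h0 => // h s hp hh s0 st.
have us := expect_unit_valued tf s0 ug.
rewrite [s + h]addrC (expectD tf)// ?(ltW hp)//.
have := H h hp hh _ us; rewrite /euler => H1.
have -> : expect (p h) (expect (p s) g) x - expect (p s) g x - generator g x * h =
  (expect (p h) (expect (p s) g) x - (expect (p s) g x + h * generator (expect (p s) g) x))
  + h * (generator (expect (p s) g) x - generator g x) by ring.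
rewrite (le_trans (ler_normD _ _))// mulrDl addrC lerD//.
rewrite normrM gtr0_norm// mulrC ler_wpM2r ?(ltW hp)// generatorB.
have lam0 := lam_ge0 x.
rewrite [leRHS](_ : _ = lam * (2 * (lam * t))); last by ring.
apply: generator_bound => y z.
have := expect_lipschitz y s0 ug; have := expect_lipschitz z s0 ug.
have : lam * s <= lam * t by rewrite ler_wpM2l.
rewrite !ler_norml => ? /andP[? ?] /andP[? ?]; apply/andP; split; lra.
Qed.

(** One-step errors add up without amplification, because an Euler step does not increase the sup
    distance. *)
Lemma expect_euler t g (m : nat) x : 0 <= t -> unit_valued g ->
  t / m.+1%:R * lam <= 1 ->
  `|expect (p t) g x - iter m.+1 (euler (t / m.+1%:R)) g x|
    <= 2 * lam ^+ 2 * t ^+ 2 / m.+1%:R.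
Proof.
move=> t0 ug; set h := t / _ => hl.
have h0 : 0 <= h by rewrite divr_ge0.
have step k y : `|expect (p (k%:R * h)) g y - iter k (euler h) g y|
    <= k%:R * (2 * lam ^+ 2 * h ^+ 2).
  move: (2 * lam ^+ 2 * h ^+ 2) (fun y f => @expect_euler1 h f y h0) => C HC.
  elim: k y => [|k IH] y.
    by rewrite !mul0r (expect0 tf)//= subrr normr0.
  rewrite /= -natr1 !mulrDl !mul1r [_ * h + h]addrC (expectD tf) ?mulr_ge0//.
  have us : unit_valued (expect (p (k%:R * h)) g).
    by apply: expect_unit_valued => //; rewrite mulr_ge0.
  rewrite -[X in `|X|](subrKA (euler h (expect (p (k%:R * h)) g) y)).
  rewrite (le_trans (ler_normD _ _))// addrC lerD//.
    exact: euler_dist.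
  exact: HC.
have := step m.+1 x.
rewrite (_ : m.+1%:R * h = t); last by rewrite /h mulrCA divff ?mulr1// pnatr_eq0.
move/le_trans; apply; rewrite /h le_eqVlt; apply/orP; left; apply/eqP.
have : m.+1%:R != 0 :> R by rewrite pnatr_eq0.
by move: (m.+1%:R) => k k0; field.
Qed.

End EulerScheme.

(** * From bounded rates to the transition function: positivity, symmetry, drift *)

Section JumpProcess.
Context {R : realType} {S : countType} {I : finType}.
Variables (jump : S -> I -> S) (rate : S -> I -> R) (lam : R).
Hypothesis rate_ge0 : forall x i, 0 <= rate x i.
Hypothesis rate_le : forall x, \sum_i rate x i <= lam.

Let lam_ge0 (x : S) : 0 <= lam.
Proof. by rewrite (le_trans _ (rate_le x))// sumr_ge0. Qed.

Section LocalRates.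
Hypothesis jump_inj : forall x, injective (jump x).
Hypothesis jump_neq : forall x i, jump x i != x.
Let q (x y : S) : R := \sum_(i | y == jump x i) rate x i.

Let q_jump x i : q x (jump x i) = rate x i.
Proof.
rewrite /q (big_pred1 i)// => j /=.
by rewrite (inj_eq (@jump_inj x)) eq_sym.
Qed.

Let exit_rateE x : exit_rate q x = \sum_i rate x i.
Proof.
rewrite /exit_rate /q.
transitivity (fine (\esum_(y in [set y | y != x]) \sum_i
    (if y == jump x i then rate x i else 0)%:E)).
  by congr fine; apply: eq_esum => y _; rewrite sumEFin big_mkcond.
rewrite esum_sum; last by move=> y i _ _; rewrite lee_fin; case: ifP.
rewrite (eq_bigr (fun i => (rate x i)%:E)) ?sumEFin// => i _.
transitivity (\esum_(y in [set jump x i]) (rate x i)%:E).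
  rewrite -(@setIidr _ [set y | y != x] [set jump x i]); last first.
    by move=> y ->; exact: jump_neq.
  rewrite esum_mkcondr; apply: eq_esum => y _.
  have [->|yj] := eqVneq y (jump x i); first by rewrite mem_set.
  by rewrite memNset// => /eqP; rewrite (negbTE yj).
by rewrite esum_set1// lee_fin.
Qed.

(** The finitely many targets of one jump are covered by [has_rates]. As the total mass is 1, the
    mass left for all other states is [o(h)] too, whatever test function is integrated against
    it. *)
Lemma has_rates_local p : transition_function p -> has_rates p q ->
  local_rates jump rate p.
Proof.
move=> tf [rq rx] x e e0.
have p_ge0 t z y : 0 <= t -> 0 <= p t z y by case: tf => + _ _ _; exact.
(* There are [1 + #|I|] error terms, each counted twice: in its own right and in the bound for the
   remaining mass. *)
pose e1 := e / (2 * (1 + #|I|%:R)).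
have c0 : 0 < 2 * (1 + #|I|%:R) :> R by rewrite mulr_gt0// ltr_wpDr.
have e10 : 0 < e1 by rewrite divr_gt0.
have N1 : \forall h \near 0^'+, `|- exit_rate q x - (p h x x - 1) / h| < e1.
  exact: cvgr_dist_lt (rx x) _ e10.
have N2 : \forall h \near 0^'+, forall i,
    `|rate x i - p h x (jump x i) / h| < e1.
  apply: filter_forall => i.
  have := rq x (jump x i); rewrite eq_sym q_jump => /(_ (jump_neq x i)) rr.
  exact: cvgr_dist_lt rr _ e10.
have [h0 h00 Hh] := near_at_right0 (filterI N1 N2).
exists h0 => // h hp hh g ug.
have {Hh} [/= + H2] := Hh h hp hh; rewrite exit_rateE => H1.
set a := p h x x - 1 + h * \sum_i rate x i.
pose b i := p h x (jump x i) - h * rate x i.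
have Ha : `|a| <= e1 * h.
  have -> : a = - ((- \sum_i rate x i - (p h x x - 1) / h) * h).
    by rewrite /a; field; rewrite gt_eqF.
  by rewrite normrN normrM (gtr0_norm hp) ler_wpM2r ?(ltW hp)// ltW.
have Hb i : `|b i| <= e1 * h.
  have -> : b i = - ((rate x i - p h x (jump x i) / h) * h).
    by rewrite /b; field; rewrite gt_eqF.
  by rewrite normrN normrM (gtr0_norm hp) ler_wpM2r ?(ltW hp)// ltW.
have hn := ltW hp.
have ge0 y : 0 <= g y by case/andP: (ug y).
pose s := x :: [seq jump x i | i <- enum I].
have us : uniq s.
  rewrite /= map_inj_uniq ?enum_uniq// andbT; apply/mapP => -[i _ /eqP].
  by rewrite eq_sym (negbTE (jump_neq x i)).
have split1 f : unit_valued f -> exists2 r, 0 <= r /\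
    r%:E = \esum_(y in [set y | y \notin s]) (p h x y * f y)%:E &
    expect (p h) f x = p h x x * f x + \sum_i p h x (jump x i) * f (jump x i) + r.
  move=> uf; have f0 y : 0 <= f y by case/andP: (uf y).
  have := expectE tf x hn uf.
  rewrite (esum_split_seq us); last by move=> y; rewrite lee_fin mulr_ge0 ?p_ge0.
  rewrite big_cons big_map big_enum/= sumEFin.
  set r := \esum_(y in _) _.
  have r0 : (0 <= r)%E.
    by apply: esum_ge0 => y _; rewrite lee_fin mulr_ge0 ?p_ge0.
  case: r r0 => [r| |]//= r0 E; exists r => //; apply: EFin_inj; exact: E.
have [rg [rg0 rgE] Eg] := split1 g ug.
have u1 : unit_valued (fun _ : S => 1 : R) by move=> y; rewrite ler01 lexx.
have [r1 [r10 r1E] E1] := split1 _ u1.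
have rg1 : rg <= r1.
  rewrite -lee_fin rgE r1E; apply: le_esum => y _; rewrite lee_fin.
  by rewrite ler_wpM2l ?p_ge0//; case/andP: (ug y).
have E1' : expect (p h) (fun=> 1) x = 1.
  apply: EFin_inj; rewrite (expectE tf)//.
  by under eq_esum do rewrite mulr1; case: tf => _ -> //.
rewrite E1' mulr1 in E1.
have sb : \sum_i p h x (jump x i) * 1 = \sum_i b i + h * \sum_i rate x i.
  rewrite mulr_sumr -big_split/=; apply: eq_bigr => i _.
  by rewrite /b mulr1; ring.
rewrite sb in E1.
have r1e : r1 = - (a + \sum_i b i) by rewrite /a; lra.
have -> : expect (p h) g x - euler jump rate h g x =
    a * g x + \sum_i b i * g (jump x i) + rg.
  have -> : \sum_i b i * g (jump x i) = \sum_i p h x (jump x i) * g (jump x i) -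
      h * \sum_i rate x i * g (jump x i).
    by rewrite mulr_sumr -sumrB; apply: eq_bigr => i _; rewrite /b; ring.
  have -> : euler jump rate h g x = g x +
      h * (\sum_i rate x i * g (jump x i) - (\sum_i rate x i) * g x).
    rewrite /euler /generator mulr_suml -sumrB.
    by congr (_ + _ * _); apply: eq_bigr => i _; ring.
  rewrite Eg /a; ring.
have nb : `|\sum_i b i| <= \sum_i `|b i| by exact: ler_norm_sum.
have nbg : `|\sum_i b i * g (jump x i)| <= \sum_i `|b i|.
  rewrite (le_trans (ler_norm_sum _ _ _))//; apply: ler_sum => i _.
  rewrite normrM ler_piMr// ger0_norm//; by case/andP: (ug (jump x i)).
have nag : `|a * g x| <= `|a|.
  rewrite normrM ler_piMr// ger0_norm//; by case/andP: (ug x).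
have sbe : \sum_i `|b i| <= #|I|%:R * (e1 * h).
  rewrite (le_trans (ler_sum _ (fun i _ => Hb i)))// sumr_const.
  by rewrite [leRHS]mulr_natl.
have ee : e * h = 2 * (1 + #|I|%:R) * (e1 * h).
  by rewrite mulrA /e1 [_ * (e / _)]mulrC divfK ?gt_eqF.
have := ler_normD (a * g x + \sum_i b i * g (jump x i)) rg.
have := ler_normD (a * g x) (\sum_i b i * g (jump x i)).
rewrite [X in _ -> _ <= _ + X -> _]ger0_norm// => n1 n2.
have n3 : r1 <= `|a| + \sum_i `|b i|.
  by rewrite r1e (le_trans (ler_norm _))// normrN (le_trans (ler_normD _ _))// lerD.
rewrite ee; lra.
Qed.
End LocalRates.

Section Consequences.
Context {p : R -> S -> S -> R}.
Hypothesis tf : transition_function p.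
Hypothesis loc : local_rates jump rate p.

Let p_ge0 t x y : 0 <= t -> 0 <= p t x y.
Proof. by case: tf => + _ _ _; exact. Qed.

Let unit_point (y : S) : unit_valued (fun z : S => (z == y)%:R : R).
Proof. by move=> z; rewrite ler0n lern1 leq_b1. Qed.

Let expect_point t x y : 0 <= t -> expect (p t) (fun z => (z == y)%:R) x = p t x y.
Proof.
move=> t0; apply: EFin_inj; rewrite (expectE tf)//.
transitivity (\esum_(z in [set y]) (p t x z)%:E); last first.
  by rewrite esum_set1// lee_fin p_ge0.
rewrite [RHS]esum_mkcond; apply: eq_esum => z _.
have [->|zy] := eqVneq z y; first by rewrite mulr1 mem_set.
by rewrite mulr0 memNset// => /eqP; rewrite (negbTE zy).
Qed.

Lemma transition_gt0_comp s t x y z : 0 <= s -> 0 <= t ->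
  0 < p s x y -> 0 < p t y z -> 0 < p (s + t) x z.
Proof.
move=> s0 t0 pxy pyz; rewrite -lte_fin.
have [_ _ _ ->]// := tf.
apply: (@lt_le_trans _ _ (p s x y * p t y z)%:E); first by rewrite lte_fin mulr_gt0.
apply: (@esum_ge_term _ _ _ (fun w => (p s x w * p t w z)%:E)) => // w.
by rewrite lee_fin mulr_ge0 ?p_ge0.
Qed.

(** Over a short time [h] the chain stays with probability at least [1 - (lam + 1) * h]; enough
    short stays are composed to cover [t]. *)
Lemma transition_gt0_refl t x : 0 <= t -> 0 < p t x x.
Proof.
rewrite le_eqVlt => /predU1P[<-|t0].
  by case: tf => _ _ -> _; rewrite eqxx.
have [h0 h00 H] := loc x (@ltr01 R).
pose M := Num.bound (t / h0 + t * (lam + 2)).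
have lam0 := lam_ge0 x.
have P1 : 0 < t / h0 by rewrite divr_gt0.
have P2 : 0 < t * (lam + 2) by rewrite mulr_gt0//; lra.
have MB : t / h0 + t * (lam + 2) < M.+1%:R.
  by rewrite (lt_le_trans (archi_boundP _))// ?ler_nat// addr_ge0 ?ltW.
pose h := t / M.+1%:R.
have hp : 0 < h by rewrite divr_gt0.
have hlt : h < h0 by rewrite /h ltr_pdivrMr// mulrC -ltr_pdivrMr//; lra.
have hlam : h * (lam + 2) < 1.
  rewrite /h mulrAC ltr_pdivrMr// mul1r; lra.
have base : 0 < p h x x.
  have := H h hp hlt _ (unit_point x); rewrite expect_point ?(ltW hp)// /euler eqxx.
  have g1 : `|generator jump rate (fun z => (z == x)%:R) x| <= lam * 1.
    apply: generator_bound => // y z.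
    have /andP[? ?] := unit_point x y; have /andP[? ?] := unit_point x z.
    by rewrite ler_norml; lra.
  move: g1; rewrite mulr1 mul1r !ler_norml => /andP[g1 _] /andP[H1 _].
  have : h * - lam <= h * generator jump rate (fun z => (z == x)%:R) x.
    by rewrite ler_wpM2l ?(ltW hp).
  simpl in *; lra.
have step k : 0 < p (k%:R * h) x x.
  elim: k => [|k IH]; first by rewrite mul0r; case: tf => _ _ -> _; rewrite eqxx.
  rewrite -natr1 mulrDl mul1r.
  have hn := ltW hp.
  by apply: (@transition_gt0_comp _ _ x x x) => //; rewrite mulr_ge0.
have := step M.+1.
by rewrite (_ : M.+1%:R * h = t)// /h mulrCA divff ?mulr1// pnatr_eq0.
Qed.

Lemma transition_gt0_jump t x i : jump x i != x -> 0 < rate x i -> 0 < t ->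
  0 < p t x (jump x i).
Proof.
move=> ne ri t0.
have r20 : 0 < rate x i / 2 by rewrite divr_gt0.
have [h0 h00 H] := loc x r20.
pose h := Num.min (h0 / 2) (t / 2).
have hp : 0 < h by rewrite lt_min !divr_gt0.
have hh0 : h < h0 by rewrite gt_min; apply/orP; left; lra.
have ht : h < t by rewrite gt_min; apply/orP; right; lra.
rewrite -(subrKC h t).
apply: (@transition_gt0_comp _ _ _ (jump x i)); rewrite ?subr_ge0 ?ltW//.
- have := H h hp hh0 _ (unit_point (jump x i)).
  rewrite expect_point ?(ltW hp)// /euler /generator eq_sym (negbTE ne) add0r.
  have : rate x i <= \sum_j rate x j * ((jump x j == jump x i)%:R - 0).
    rewrite (bigD1 i)//= eqxx subr0 mulr1 lerDl sumr_ge0// => j _.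
    by rewrite subr0 mulr_ge0.
  move=> g1; have : h * rate x i <= h * \sum_j rate x j * ((jump x j == jump x i)%:R - 0).
    by rewrite ler_wpM2l ?(ltW hp).
  rewrite ler_norml => ? /andP[? _].
  have : 0 < h * (rate x i / 2) by rewrite mulr_gt0.
  by lra.
- by apply: transition_gt0_refl; rewrite subr_ge0 ltW.
Qed.
End Consequences.

Lemma le_of_archi (a b c : R) (N : nat) :
  (forall m : nat, (N <= m)%N -> a <= b + c / m.+1%:R) -> a <= b.
Proof.
move=> H; apply/ler_addgt0Pr => e e0.
pose m := maxn N (Num.bound (`|c| / e)).
apply: (le_trans (H m (leq_maxl _ _))); rewrite lerD2l ler_pdivrMr//.
rewrite (le_trans (ler_norm _))// mulrC -ler_pdivrMr//.
rewrite ltW// (lt_le_trans (archi_boundP _))// ?divr_ge0// ?(ltW e0)//.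
by rewrite ler_nat ltnW// ltnS leq_maxr.
Qed.

Let step_small (t a : R) (m : nat) : 0 <= t -> 0 <= a ->
  (Num.bound (t * a) <= m)%N -> t / m.+1%:R * a <= 1.
Proof.
move=> t0 a0 mN; rewrite mulrAC ler_pdivrMr// mul1r.
rewrite ltW// (lt_le_trans (archi_boundP _))// ?mulr_ge0//.
by rewrite ler_nat ltnW.
Qed.

(* The Euler approximants only see the rates, so transition functions with the
   same rates agree, and they inherit any symmetry of the rates. *)
Lemma expect_invariant (rel : S -> S -> Prop) p p' t f x x' :
  (forall h f, (forall y y', rel y y' -> f y = f y') ->
     forall y y', rel y y' -> euler jump rate h f y = euler jump rate h f y') ->
  transition_function p -> local_rates jump rate p ->
  transition_function p' -> local_rates jump rate p' ->
  0 <= t -> unit_valued f -> (forall y y', rel y y' -> f y = f y') -> rel x x' ->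
  expect (p t) f x = expect (p' t) f x'.
Proof.
move=> inv tf loc tf' loc' t0 uf rf rx.
have lam0 := lam_ge0 x.
have invk h k : forall y y', rel y y' ->
    iter k (euler jump rate h) f y = iter k (euler jump rate h) f y'.
  by elim: k => [//|k IH] y y' ryy'; exact: inv ryy'.
have key (m : nat) : (Num.bound (t * lam) <= m)%N ->
    `|expect (p t) f x - expect (p' t) f x'| <=
    0 + (4 * lam ^+ 2 * t ^+ 2) / m.+1%:R.
  move=> mN; have sm := step_small t0 lam0 mN.
  have := expect_euler rate_ge0 rate_le tf loc x t0 uf sm.
  have := expect_euler rate_ge0 rate_le tf' loc' x' t0 uf sm.
  rewrite (invk _ _ _ _ rx) => H1 H2.
  rewrite -(subrKA (iter m.+1 (euler jump rate (t / m.+1%:R)) f x')).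
  rewrite (le_trans (ler_normD _ _))// [X in _ + X]distrC.
  rewrite (_ : 0 + _ = 2 * lam ^+ 2 * t ^+ 2 / m.+1%:R +
    2 * lam ^+ 2 * t ^+ 2 / m.+1%:R); last by ring.
  by rewrite lerD.
have := le_of_archi key; rewrite normr_le0 subr_eq0 => /eqP; exact.
Qed.

(** * Drift bounds passed from the generator to the transition function *)

Section Lyapunov.
Variables (V : S -> R) (delta C : R).
Hypotheses (V_ge0 : forall x, 0 <= V x) (delta_gt0 : 0 < delta)
  (C_ge0 : 0 <= C).
Hypothesis drift : forall x, generator jump rate V x <= - delta * V x + C.

Let iter_le h k (f g : S -> R) : 0 <= h -> h * lam <= 1 ->
  (forall x, f x <= g x) ->
  forall x, iter k (euler jump rate h) f x <= iter k (euler jump rate h) g x.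
Proof.
move=> h0 hl fg; elim: k => [|k IH] x /=; first exact: fg.
exact: (le_euler jump rate_ge0 rate_le h0 hl IH x).
Qed.

(** [C / delta] is the fixed point of the affine recursion that bounds an Euler step of [V]. *)
Let iter_drift h k x : 0 <= h -> h * lam <= 1 -> h * delta <= 1 ->
  iter k (euler jump rate h) V x <=
    (1 - h * delta) ^+ k * (V x - C / delta) + C / delta.
Proof.
move=> h0 hl hd; elim: k x => [|k IH] x; first by rewrite expr0 mul1r subrK.
rewrite iterS (le_trans (le_euler jump rate_ge0 rate_le h0 hl IH x))//.
set c := (1 - _) ^+ k.
have c0 : 0 <= c by rewrite exprn_ge0// subr_ge0.
have -> : euler jump rate h (fun y => c * (V y - C / delta) + C / delta) x =
    c * euler jump rate h V x + (C / delta - c * (C / delta)).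
  rewrite -euler_affine; congr (euler _ _ _ _ _); apply/funext => y; ring.
have H : euler jump rate h V x <= (1 - h * delta) * V x + h * C.
  rewrite /euler (le_trans (lerD (lexx _) (ler_wpM2l h0 (drift x))))//.
  by rewrite le_eqVlt; apply/orP; left; apply/eqP; ring.
rewrite exprS (le_trans (lerD (ler_wpM2l c0 H) (lexx _)))//.
rewrite le_eqVlt; apply/orP; left; apply/eqP; rewrite -/c; field.
by rewrite gt_eqF.
Qed.

(** [V] may be unbounded, so the Euler estimate is applied to its restriction to a finite set,
    scaled into [0, 1]. By monotonicity its iterates lie below those of [V], scaled likewise, and
    the resulting bound does not depend on the set. *)
Lemma expect_lyapunov p t x : transition_function p ->
  local_rates jump rate p -> 0 <= t ->
  (\esum_(y in [set: S]) (p t x y * V y)%:E <=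
    (expR (- (delta * t)) * V x + C / delta)%:E)%E.
Proof.
move=> tf loc t0; apply: ge_ereal_sup => /= _ [A [finA _] <-].
have lam0 := lam_ge0 x.
have p_ge0 z y : 0 <= p t z y by case: tf => + _ _ _; exact.
have C0 : 0 <= C / delta by rewrite divr_ge0// ltW.
pose M : R := 1 + \sum_(y <- finmap.enum_fset (fset_set A)) V y.
have M0 : 0 < M by rewrite ltr_wpDr// sumr_ge0.
pose f y := if y \in A then V y / M else 0.
have uf : unit_valued f.
  move=> y; rewrite /f; case: ifPn => [yA|_]; last by rewrite lexx ler01.
  rewrite divr_ge0 ?(ltW M0)//= ler_pdivrMr// mul1r /M.
  have yF : y \in finmap.enum_fset (fset_set A) by rewrite in_fset_set.
  rewrite (big_rem y)//=.
  set s0 := rem _ _; have : 0 <= \sum_(z <- s0) V z by rewrite sumr_ge0.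
  lra.
have Mn0 : M != 0 by rewrite gt_eqF.
have fV y : f y <= M^-1 * V y + 0.
  rewrite addr0 /f; case: ifP => _; first by rewrite mulrC.
  by rewrite mulr_ge0// invr_ge0 ltW.
apply: (@le_trans _ _ (M * expect (p t) f x)%:E).
  rewrite EFinM (expectE tf)// -esumZl ?lee_fin ?(ltW M0)//; last first.
    by move=> y; rewrite lee_fin mulr_ge0//; case/andP: (uf y).
  apply: esum_ge; exists A => //; apply: lee_fsum => // y yA.
  by rewrite -EFinM lee_fin /f mem_set// [leRHS]mulrCA [M * _]mulrC divfK.
rewrite lee_fin mulrC -ler_pdivlMr// mulrC.
pose c := 2 * lam ^+ 2 * t ^+ 2.
apply: (@le_of_archi _ _ c (Num.bound (t * lam) + Num.bound (t * delta))) => m mN.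
have sl := step_small t0 lam0 (leq_trans (leq_addr _ _) mN).
have sd := step_small t0 (ltW delta_gt0) (leq_trans (leq_addl _ _) mN).
set h := t / m.+1%:R in sl sd *.
have h0 : 0 <= h by rewrite divr_ge0.
have := expect_euler rate_ge0 rate_le tf loc x t0 uf sl.
rewrite ler_norml => /andP[_]; rewrite lerBlDl => /le_trans; apply; rewrite lerD2r.
apply: (le_trans (iter_le m.+1 h0 sl fV x)).
have -> : iter m.+1 (euler jump rate h) (fun y => M^-1 * V y + 0) x =
    M^-1 * iter m.+1 (euler jump rate h) V x + 0.
  elim: m.+1 x => [//|k IH] y /=.
  by rewrite -euler_affine; congr (euler _ _ _ _ _); apply/funext => z.
rewrite addr0 ler_wpM2l ?invr_ge0 ?(ltW M0)//.
apply: (le_trans (iter_drift m.+1 x h0 sl sd)).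
rewrite lerD2r.
have q0 : 0 <= (1 - h * delta) ^+ m.+1 by rewrite exprn_ge0// subr_ge0.
apply: (@le_trans _ _ ((1 - h * delta) ^+ m.+1 * V x)).
  by rewrite ler_wpM2l// gerBl.
rewrite ler_wpM2r//.
have -> : - (delta * t) = m.+1%:R * - (h * delta).
  have : m.+1%:R != 0 :> R by rewrite pnatr_eq0.
  by rewrite /h; move: (m.+1%:R) => k k0; field.
rewrite expRM_natl lerXn2r// ?nnegrE ?expR_ge0 ?subr_ge0//.
exact: expR_ge1Dx.
Qed.
End Lyapunov.
End JumpProcess.

(** * Positive kernels with a Lyapunov function *)

Section Kernel.
Context {R : realType} {D : countType} (k : D -> D -> R).
Hypothesis k_ge0 : forall x y, 0 <= k x y.
Local Open Scope ereal_scope.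

Definition kernel_on (A : set D) (f : D -> \bar R) (x : D) : \bar R :=
  \esum_(y in A) ((k x y)%:E * f y).

Lemma kernel_on_ge0 A f : (forall y, 0 <= f y) -> forall x, 0 <= kernel_on A f x.
Proof. by move=> f0 x; apply: esum_ge0 => y _; rewrite mule_ge0// lee_fin. Qed.

Lemma le_kernel_on A f g : (forall y, f y <= g y) ->
  forall x, kernel_on A f x <= kernel_on A g x.
Proof. by move=> fg x; apply: le_esum => y _; rewrite lee_wpmul2l ?lee_fin. Qed.

Lemma kernel_onZ A (c : \bar R) f x : 0 <= c -> (forall y, 0 <= f y) ->
  kernel_on A (fun y => c * f y) x = c * kernel_on A f x.
Proof.
move=> c0 f0; rewrite /kernel_on -esumZl//; last first.
  by move=> y; rewrite mule_ge0// lee_fin.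
by apply: eq_esum => y _; rewrite muleCA.
Qed.

Lemma kernel_onD A f g x : (forall y, 0 <= f y) -> (forall y, 0 <= g y) ->
  kernel_on A (fun y => f y + g y) x = kernel_on A f x + kernel_on A g x.
Proof.
move=> f0 g0; rewrite /kernel_on -esumD; last 2 first.
- by move=> y _; rewrite mule_ge0// lee_fin.
- by move=> y _; rewrite mule_ge0// lee_fin.
by apply: eq_esum => y _; rewrite ge0_muleDr.
Qed.

Lemma le_iter_kernel_on A f g j : (forall y, f y <= g y) ->
  forall x, iter j (kernel_on A) f x <= iter j (kernel_on A) g x.
Proof. by move=> fg; elim: j => //= j IH; exact: le_kernel_on. Qed.

End Kernel.

Section PositiveKernel.
Context {R : realType} {D : countType} (k : D -> D -> R).
Hypothesis k_gt0 : forall x y, 0 < k x y.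
Hypothesis k_sum1 : forall x, \esum_(y in [set: D]) (k x y)%:E = 1%E.

Let k_ge0 x y : 0 <= k x y. Proof. exact: ltW. Qed.

(** [v - u] is nonnegative, invariant and positive somewhere, hence positive everywhere as the
    kernel is. *)
Let invariant_lt (u v : D -> R) x0 :
  (forall x, 0 <= u x) -> (forall x, u x <= v x) ->
  (forall y, \esum_(x in [set: D]) (u x * k x y)%:E = (u y)%:E) ->
  (forall y, \esum_(x in [set: D]) (v x * k x y)%:E = (v y)%:E) ->
  u x0 < v x0 -> forall y, u y < v y.
Proof.
move=> u0 uv ui vi uv0 y; rewrite -lte_fin -vi.
rewrite (eq_esum (b := fun x => ((u x * k x y)%:E + ((v x - u x) * k x y)%:E)%E)).
  have vuk x : 0 <= (v x - u x) * k x y by rewrite mulr_ge0// subr_ge0.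
  rewrite esumD; last 2 first.
  - by move=> x _; rewrite lee_fin mulr_ge0.
  - by move=> x _; rewrite lee_fin.
  rewrite ui lteDl//; apply: (@lt_le_trans _ _ ((v x0 - u x0) * k x0 y)%:E).
    by rewrite lte_fin mulr_gt0// subr_gt0.
  by apply: (@esum_ge_term _ _ _ (fun x => ((v x - u x) * k x y)%:E)) => // x; rewrite lee_fin.
by move=> x _; rewrite -EFinD; congr (_%:E); ring.
Qed.

(* The pointwise minimum of two invariant probabilities is again invariant, so
   by positivity of the kernel it is either equal to the first one or strictly
   below it everywhere. *)
Lemma invariant_unique (f g : D -> R) :
  (forall x, 0 <= f x) -> (forall x, 0 <= g x) ->
  \esum_(x in [set: D]) (f x)%:E = 1%E -> \esum_(x in [set: D]) (g x)%:E = 1%E ->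
  (forall y, \esum_(x in [set: D]) (f x * k x y)%:E = (f y)%:E) ->
  (forall y, \esum_(x in [set: D]) (g x * k x y)%:E = (g y)%:E) ->
  f = g.
Proof.
move=> f0 g0 f1 g1 fi gi; pose h x := Num.min (f x) (g x).
have h0 x : 0 <= h x by rewrite le_min f0 g0.
have hf x : h x <= f x by rewrite ge_min lexx.
have hg x : h x <= g x by rewrite ge_min lexx orbT.
have hk y : (\esum_(x in [set: D]) (h x * k x y)%:E <= (h y)%:E)%E.
  rewrite [in leRHS]/h minEle; case: ifP => _; [rewrite -fi|rewrite -gi];
    by apply: le_esum => x _; rewrite lee_fin ler_wpM2r.
have hk0 y : (0 <= \esum_(x in [set: D]) (h x * k x y)%:E)%E.
  by apply: esum_ge0 => x _; rewrite lee_fin mulr_ge0.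
pose h' y := fine (\esum_(x in [set: D]) (h x * k x y)%:E).
have h'E y : (h' y)%:E = \esum_(x in [set: D]) (h x * k x y)%:E.
  by rewrite /h' fineK// ge0_fin_numE// (le_lt_trans (hk y))// ltry.
(* [h'], the image of [h] under the kernel, lies below [h] and has the same total mass, since rows
   sum to 1. *)
have h'h : h' = h.
  apply: esum_eq_le.
  - by move=> x; rewrite -lee_fin h'E.
  - by move=> x; rewrite -lee_fin h'E.
  - rewrite (eq_esum (a := fun y => (h' y)%:E) (fun y _ => h'E y)).
    rewrite esum_exchange; last by move=> x y; rewrite lee_fin mulr_ge0.
    apply: le_esum => x _; rewrite -[leLHS]mule1 -(k_sum1 x) -esumZl ?lee_fin//.
    by move=> y; rewrite lee_fin.
  - apply: (@le_lt_trans _ _ 1%E); last by rewrite ltry.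
    by rewrite -f1; apply: le_esum => x _; rewrite h'E (le_trans (hk x))// lee_fin.
have hi y : \esum_(x in [set: D]) (h x * k x y)%:E = (h y)%:E.
  by rewrite -h'E h'h.
have [[x0 hfx0]|nlt] := pselect (exists x, h x < f x).
  apply/esym/esum_eq_le => //; rewrite ?f1 ?g1 ?ltry// => y.
  have := invariant_lt h0 hf hi fi hfx0 y.
  by rewrite /h minEle; case: ifP => [_|/negbT]; rewrite ?ltxx// -ltNge => /ltW.
apply: esum_eq_le => //; rewrite ?f1 ?g1 ?ltry// => y.
rewrite (le_trans _ (hg y))// leNgt; apply/negP => hfy.
by apply: nlt; exists y.
Qed.

(** * Excursions from a fixed state under a drift condition *)

Section Lyapunov.
Variables (V : D -> R) (a b : R).
Hypothesis V_ge0 : forall x, 0 <= V x.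
Hypotheses (a_ge0 : 0 <= a) (a_lt1 : a < 1) (b_ge0 : 0 <= b).
Hypothesis drift : forall x,
  (\esum_(y in [set: D]) (k x y * V y)%:E <= (a * V x + b)%:E)%E.
Hypothesis small : forall K z, exists2 e, 0 < e & forall x, V x <= K -> e <= k x z.
Variable z : D.
Let A := [set y | y != z].

Let taboo1 x : kernel_on k A (fun=> 1%E) x = (1 - k x z)%:E.
Proof.
have := k_sum1 x; rewrite (esumID [set z])/=; last by move=> *; rewrite lee_fin.
rewrite setTI setTI esum_set1 ?lee_fin//.
rewrite (_ : ~` [set z] = A); last first.
  by apply/seteqP; split=> y /= /eqP.
rewrite /kernel_on; under [in X in _ -> X = _]eq_esum do rewrite mule1.
case: esum => [r| |]//= E; rewrite -(EFin_inj E); congr (_%:E); ring.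
Qed.

(** Killing at [z] removes at least [B * e] from the constant [B] where [V <= K], which pays for
    [b]; where [V] exceeds [K], the drift of [V] pays for it. *)
Lemma taboo_contraction : exists W : D -> R, exists B s : R,
  [/\ [/\ 0 < s, s <= 1, 0 <= B & forall x, W x = V x + B], forall x, 1 <= W x
   & forall x, (kernel_on k A (EFin \o W) x <= ((1 - s) * W x)%:E)%E].
Proof.
have a1 : 0 < 1 - a by rewrite subr_gt0.
(* Beyond [K] the loss [(1 - a) * V x] is at least [b + 1]. *)
pose K := (b + 1) / (1 - a).
have K0 : 0 <= K by rewrite divr_ge0 ?(ltW a1)// addr_ge0.
have [e e0 He] := small K z.
(* [B * e] is at least [b + 1]; the added 1 gives [W >= 1]. *)
pose B := (b + 1) / e + 1.
have B1 : 1 <= B by rewrite /B lerDr divr_ge0 ?(ltW e0)// addr_ge0.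
(* Where [V <= K] the net loss is at least 1 while [W <= K + B], hence the second bound; for large
   [V] the rate cannot exceed [1 - a]. *)
pose s := Num.min (1 - a) (K + B)^-1.
have KB : 0 < K + B by lra.
have s0 : 0 < s by rewrite lt_min a1 invr_gt0.
have sa : s <= 1 - a by rewrite ge_min lexx.
have sKB : s * (K + B) <= 1.
  by rewrite -ler_pdivlMr// mul1r ge_min lexx orbT.
exists (fun x => V x + B), B, s; split.
- by split => //; [rewrite (le_trans sa)// gerBl|exact: le_trans B1].
- by move=> x; have := V_ge0 x; lra.
move=> x; pose f x := (V x)%:E.
have -> : EFin \o (fun x => V x + B) = (fun y => f y + B%:E * 1)%E.
  by apply/funext => y /=; rewrite mule1 EFinD.
have B0 : 0 <= B by lra.
have f0 y : (0 <= f y)%E by rewrite lee_fin.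
rewrite kernel_onD//; last by move=> y; rewrite mule1 lee_fin.
rewrite kernel_onZ ?lee_fin// taboo1 -EFinM.
have H1 : (kernel_on k A f x <= (a * V x + b)%:E)%E.
  by apply: le_trans (drift x); exact: le_esum_set.
apply: (le_trans (leeD H1 (lexx _))); rewrite -EFinD lee_fin.
have Vx := V_ge0 x; have kz := k_gt0 x z.
have [VK|KV] := leP (V x) K.
  have H2 := He x VK.
  have Be : b + 1 <= B * k x z.
    apply: (@le_trans _ _ (B * e)); last by rewrite ler_wpM2l.
    by rewrite /B mulrDl divfK ?gt_eqF//; lra.
  have : s * (V x + B) <= s * (K + B) by rewrite ler_wpM2l ?(ltW s0)//; lra.
  have : a * V x <= V x by rewrite ler_piMl// ltW.
  lra.
have E1 : (1 - a - s) * K <= (1 - a - s) * V x by rewrite ler_wpM2l ?(ltW KV)//; lra.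
have E2 : (1 - a) * K = b + 1 by rewrite /K mulrC divfK// gt_eqF.
have E3 : 0 <= B * k x z by rewrite mulr_ge0.
lra.
Qed.

Let W := projT1 (cid taboo_contraction).
Let HB := projT2 (cid taboo_contraction).
Let B := projT1 (cid HB).
Let Hs := projT2 (cid HB).
Let s := projT1 (cid Hs).
Let HW := projT2 (cid Hs).

Let s_gt0 : 0 < s. Proof. by have [[]] := HW. Qed.
Let s_le1 : s <= 1. Proof. by have [[]] := HW. Qed.
Let B_ge0 : 0 <= B. Proof. by have [[]] := HW. Qed.
Let WE x : W x = V x + B. Proof. by have [[]] := HW. Qed.
Let W_ge1 x : 1 <= W x. Proof. by have [] := HW. Qed.
Let W_taboo x : (kernel_on k A (EFin \o W) x <= ((1 - s) * W x)%:E)%E.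
Proof. by have [] := HW. Qed.
Let W_ge0 x : 0 <= W x. Proof. exact: le_trans (W_ge1 x). Qed.
Let s1_ge0 : 0 <= 1 - s. Proof. by rewrite subr_ge0. Qed.

Let iter_taboo_le j x :
  (iter j (kernel_on k A) (EFin \o W) x <= ((1 - s) ^+ j * W x)%:E)%E.
Proof.
elim: j x => [|j IH] x; first by rewrite expr0 mul1r.
rewrite iterS (le_trans (le_kernel_on k_ge0 _ IH x))//.
have -> : (fun y => ((1 - s) ^+ j * W y)%:E) = (fun y => ((1 - s) ^+ j)%:E * (EFin \o W) y)%E.
  by apply/funext => y /=; rewrite EFinM.
rewrite kernel_onZ ?lee_fin ?exprn_ge0//.
rewrite exprSr -mulrA [leRHS]EFinM lee_wpmul2l ?lee_fin ?exprn_ge0//.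
Qed.

(** The free steps keep the expectation of [V] below [V z + b / (1 - a)] whatever their number, and
    each step avoiding [z] contracts [W] by [1 - s]. Uniformity in [i] lets a return be sought after
    any number of free steps. *)
Lemma taboo_geometric : exists r : R, exists c : R, [/\ 0 <= r, r < 1, 0 <= c &
  forall i j, (iter i (kernel_on k setT) (iter j (kernel_on k A) (fun=> 1)) z
    <= (r ^+ j * c)%:E)%E].
Proof.
pose c0 := b / (1 - a).
have a1 : 0 < 1 - a by rewrite subr_gt0.
have c00 : 0 <= c0 by rewrite divr_ge0// ltW.
exists (1 - s), (W z + c0); split => //; [by rewrite gtrBl|by rewrite addr_ge0|move=> i j].
have kV c d x : 0 <= c -> 0 <= d ->
    (kernel_on k setT (fun y => (c * V y + d)%:E) x <= (c * (a * V x + b) + d)%:E)%E.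
  move=> c0' d0.
  have -> : (fun y => (c * V y + d)%:E) = (fun y => c%:E * (V y)%:E + d%:E * 1)%E.
    by apply/funext => y; rewrite mule1.
  have V0 y : (0 <= (V y)%:E)%E by rewrite lee_fin.
  rewrite kernel_onD//; last 2 first.
  - by move=> y; rewrite mule_ge0.
  - by move=> y; rewrite mule1 lee_fin.
  rewrite !kernel_onZ ?lee_fin//.
  rewrite {2}/kernel_on; under [X in (_ + _ * X)%E]eq_esum do rewrite mule1.
  rewrite k_sum1 mule1 !EFinD EFinM leeD2r// lee_wpmul2l ?lee_fin//.
  exact: drift.
have iterW q x : 0 <= q -> (iter i (kernel_on k setT) (fun y => (q * W y)%:E) x <=
    (q * a ^+ i * V x + q * (c0 * (1 - a ^+ i) + B))%:E)%E.
  move=> q0; elim: i x => [|i IH] x /=.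
    rewrite lee_fin expr0 mulr1 subrr mulr0 add0r WE; lra.
  have ai0 : 0 <= a ^+ i by rewrite exprn_ge0.
  have ai1 : a ^+ i <= 1 by rewrite exprn_ile1// ltW.
  rewrite (le_trans (le_kernel_on k_ge0 _ IH x))//.
  apply: (le_trans (kV _ _ x _ _)).
  - by rewrite mulr_ge0.
  - by rewrite mulr_ge0// addr_ge0// mulr_ge0// subr_ge0.
  have e1 : b = (1 - a) * c0 by rewrite /c0 mulrC divfK// gt_eqF.
  rewrite lee_fin le_eqVlt; apply/orP; left; apply/eqP.
  by rewrite e1 exprS; ring.
have q0 : 0 <= (1 - s) ^+ j by rewrite exprn_ge0.
apply: (@le_trans _ _ (iter i (kernel_on k setT) (fun y => ((1 - s) ^+ j * W y)%:E) z)).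
  apply: le_iter_kernel_on => // y; apply: le_trans (iter_taboo_le j y).
  by apply: le_iter_kernel_on => // w; rewrite lee_fin.
rewrite (le_trans (iterW _ _ q0))// lee_fin -mulrA -mulrDr ler_wpM2l// WE.
have ai0 : 0 <= a ^+ i by rewrite exprn_ge0.
have ai1 : a ^+ i <= 1 by rewrite exprn_ile1// ltW.
have : a ^+ i * V z <= V z by rewrite ler_piMl.
have : 0 <= c0 * a ^+ i by rewrite mulr_ge0.
lra.
Qed.

(* [visits j y] is the probability, starting from [z], of being at [y] at time
   [j] without having returned to [z] in the meantime. *)
Fixpoint visits (j : nat) (y : D) : \bar R :=
  if j is j'.+1 then
    if y == z then 0%E else \esum_(x in [set: D]) (visits j' x * (k x y)%:E)%E
  else (y == z)%:R%:E.

Let occupation (y : D) : \bar R := \esum_(j in [set: nat]) visits j y.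

Let visits_ge0 j y : (0 <= visits j y)%E.
Proof.
elim: j y => [|j IH] y /=; first by rewrite lee_fin.
by case: ifP => // _; apply: esum_ge0 => x _; rewrite mule_ge0// lee_fin.
Qed.

Let occupation_ge0 y : (0 <= occupation y)%E.
Proof. exact: esum_ge0. Qed.

(** Duality: one more step of the measure is one killed step of the function. *)
Let visitsS j (F : D -> \bar R) : (forall y, 0 <= F y)%E ->
  \esum_(y in [set: D]) (visits j.+1 y * F y)%E =
  \esum_(x in [set: D]) (visits j x * kernel_on k A F x)%E.
Proof.
move=> F0.
transitivity (\esum_(y in A) \esum_(x in [set: D]) (visits j x * ((k x y)%:E * F y))%E).
  rewrite [RHS]esum_mkcond; apply: eq_esum => y _ /=.
  have [->|yz] := eqVneq y z.
    by rewrite mul0e memNset// /A /= eqxx.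
  rewrite mem_set// muleC -esumZl//; last by move=> x; rewrite mule_ge0// lee_fin.
  by apply: eq_esum => x _; rewrite muleC muleA.
rewrite esum_exchange; last first.
  by move=> y x; rewrite !mule_ge0// lee_fin.
apply: eq_esum => x _; rewrite -esumZl// => y.
by rewrite mule_ge0// lee_fin.
Qed.

Let visitsW j :
  (\esum_(y in [set: D]) (visits j y * (W y)%:E) <= ((1 - s) ^+ j * W z)%:E)%E.
Proof.
have W0 y : (0 <= (W y)%:E)%E by rewrite lee_fin.
elim: j => [|j IH].
  rewrite expr0 mul1r -[leRHS](@esum_set1 _ _ z (EFin \o W))//= [leRHS]esum_mkcond.
  apply: le_esum => y _ /=; have [->|yz] := eqVneq y z.
    by rewrite mul1e mem_set.
  by rewrite mul0e; case: ifP.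
rewrite visitsS//.
apply: (@le_trans _ _ (\esum_(x in [set: D]) ((1 - s)%:E * (visits j x * (W x)%:E))%E)).
  apply: le_esum => x _; by rewrite [leRHS]muleCA lee_wpmul2l.
rewrite esumZl ?lee_fin//; last by move=> x; rewrite mule_ge0.
by rewrite exprS -mulrA EFinM lee_wpmul2l ?lee_fin.
Qed.

Let occupationW :
  (\esum_(y in [set: D]) (occupation y * (W y)%:E) <= (W z / s)%:E)%E.
Proof.
have W0 y : (0 <= (W y)%:E)%E by rewrite lee_fin.
apply: (@le_trans _ _ (\esum_(j in [set: nat]) ((1 - s) ^+ j * W z)%:E)); last first.
  rewrite (_ : W z / s = W z / (1 - (1 - s))); last by congr (_ / _); ring.
  by apply: esum_geometric_le => //; rewrite gtrBl.
apply: (@le_trans _ _ (\esum_(j in [set: nat])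
    \esum_(y in [set: D]) (visits j y * (W y)%:E)%E)).
  rewrite esum_exchange; last by move=> j y; rewrite mule_ge0.
  apply: le_esum => y _; rewrite muleC -esumZl//.
  by apply: le_esum => j _; rewrite muleC.
by apply: le_esum => j _.
Qed.

Let occupation_fin y : occupation y \is a fin_num.
Proof.
rewrite ge0_fin_numE//; apply: (@le_lt_trans _ _ (W z / s)%:E); last by rewrite ltry.
apply: (le_trans _ occupationW).
apply: (@le_trans _ _ (occupation y * (W y)%:E)%E).
  by rewrite -[leLHS]mule1 lee_wpmul2l// lee_fin.
apply: (@esum_ge_term _ _ _ (fun y => occupation y * (W y)%:E)%E) => // x.
by rewrite mule_ge0// lee_fin.
Qed.

Let occupation_mass : \esum_(y in [set: D]) occupation y \is a fin_num.
Proof.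
rewrite ge0_fin_numE ?esum_ge0//.
apply: (@le_lt_trans _ _ (W z / s)%:E); last by rewrite ltry.
apply: (le_trans _ occupationW); apply: le_esum => y _.
by rewrite -[leLHS]mule1 lee_wpmul2l// lee_fin.
Qed.

(** Away from [z] this is a shift of the time index. At [z] it follows from conservation of mass:
    rows sum to 1, the total mass is finite, and both sides agree at all other states. *)
Let occupation_invariant y :
  \esum_(x in [set: D]) (occupation x * (k x y)%:E)%E = occupation y.
Proof.
pose Ok y := \esum_(x in [set: D]) (occupation x * (k x y)%:E)%E.
have Ok_ge0 y' : (0 <= Ok y')%E.
  by apply: esum_ge0 => x _; rewrite mule_ge0// lee_fin.
have OkA y' : y' != z -> Ok y' = occupation y'.
  move=> yz; rewrite /Ok /occupation [RHS]esum_natS//= (negbTE yz) add0e.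
  rewrite [RHS]esum_exchange; last by move=> j x; rewrite mule_ge0// lee_fin.
  apply: eq_esum => x _; rewrite muleC -esumZl ?lee_fin//.
  by apply: eq_esum => j _; rewrite muleC.
have [->|yz] := eqVneq y z; last exact: OkA.
have E : \esum_(y in [set: D]) Ok y = \esum_(y in [set: D]) occupation y.
  rewrite /Ok esum_exchange; last by move=> y' x; rewrite mule_ge0// lee_fin.
  apply: eq_esum => x _; rewrite esumZl// => [|y']; last by rewrite lee_fin.
  by rewrite k_sum1 mule1.
have spl (F : D -> \bar R) : (forall y, 0 <= F y)%E -> \esum_(y in [set: D]) F y =
    (F z + \esum_(y in ~` [set z]) F y)%E.
  by move=> F0; rewrite (esumID [set z])// !setTI esum_set1.
have := occupation_mass; move: E.
rewrite (spl Ok)// (spl occupation)// (@eq_esum _ _ (~` [set z]) Ok occupation); last first.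
  by move=> y' /= /eqP; exact: OkA.
set r := \esum_(y in ~` _) _ => E F.
have rfin : r \is a fin_num.
  rewrite ge0_fin_numE; last by apply: esum_ge0 => *.
  rewrite (le_lt_trans _ (_ : (occupation z + r < +oo)%E))//.
    by rewrite leeDr.
  by rewrite -ge0_fin_numE// adde_ge0// esum_ge0.
move/(congr1 (fun u => u - r)%E): E; rewrite !addeK//.
Qed.

Lemma exists_invariant : exists mu : D -> R, exists C : R,
  [/\ forall x, 0 <= mu x, \esum_(x in [set: D]) (mu x)%:E = 1%E,
    forall y, \esum_(x in [set: D]) (mu x * k x y)%:E = (mu y)%:E
  & (\esum_(x in [set: D]) (mu x * V x)%:E <= C%:E)%E].
Proof.
pose M := fine (\esum_(y in [set: D]) occupation y).
have ME : M%:E = \esum_(y in [set: D]) occupation y by rewrite /M fineK.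
have M0 : 0 < M.
  rewrite -lte_fin ME (lt_le_trans _ (esum_ge_term (x := z) _ _))//.
  rewrite (lt_le_trans _ (esum_ge_term (x := 0%N) _ _))//=.
  by rewrite eqxx lte_fin.
have Mi0 : 0 <= M^-1 by rewrite invr_ge0 ltW.
pose mu y := M^-1 * fine (occupation y).
have muE y : (mu y)%:E = (M^-1%:E * occupation y)%E by rewrite /mu EFinM fineK.
exists mu, (M^-1 * (W z / s)); split.
- by move=> x; rewrite mulr_ge0// fine_ge0.
- rewrite (eq_esum (fun y _ => muE y)) esumZl ?lee_fin// -ME -EFinM mulVf//.
  by rewrite gt_eqF.
- move=> y; rewrite muE -(occupation_invariant y) -esumZl ?lee_fin//; last first.
    by move=> x; rewrite mule_ge0// lee_fin.
  by apply: eq_esum => x _; rewrite EFinM muE muleA.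
- rewrite EFinM (le_trans _ (lee_wpmul2l _ occupationW)) ?lee_fin//.
  rewrite -esumZl ?lee_fin//; last by move=> x; rewrite mule_ge0// lee_fin.
  apply: le_esum => x _; rewrite EFinM muE -muleA lee_wpmul2l ?lee_fin//.
  by rewrite lee_wpmul2l// lee_fin WE lerDl.
Qed.
End Lyapunov.
End PositiveKernel.

(** * The Lyapunov function of the crystal *)

(** Invert [1 - u <= expR (- u)], then use [(1 + u + 2 * u ^+ 2) * (1 - u) = 1 + u ^+ 2 * (1 - 2 *
    u)]. *)
Lemma expR_le_quadratic {R : realType} (u : R) : `|u| <= 1 / 2 ->
  expR u <= 1 + u + 2 * u ^+ 2.
Proof.
rewrite ler_norml => /andP[u1 u2].
have h1 : 0 < 1 - u by lra.
have H : 1 - u <= expR (- u) by exact: expR_ge1Dx.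
have e0 := expR_gt0 u.
have E : expR u * (1 - u) <= 1.
  by rewrite -[leRHS](expRxMexpNx_1 u) ler_wpM2l// ltW.
have : expR u <= (1 - u)^-1 by rewrite -[leRHS]mul1r ler_pdivlMr.
move/le_trans; apply; rewrite -[leLHS]mul1r ler_pdivrMr//.
have : 0 <= u ^+ 2 * (1 - 2 * u) by rewrite mulr_ge0 ?sqr_ge0//; lra.
by rewrite !expr2 => ?; lra.
Qed.

Section NatDistance.
Implicit Types i j m n : nat.

(** With truncated subtraction, [i - j + (j - i)] is the distance between [i] and [j]. *)
Lemma dist_le n i j : (i < n -> j < n -> i - j + (j - i) <= n)%N.
Proof. lia. Qed.

Lemma dist_succ m j : (j < m -> m - j + (j - m) = (m - j.+1 + (j.+1 - m)).+1)%N.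
Proof. lia. Qed.

Lemma dist_pred m j : (m < j -> m - j + (j - m) = (m - j.-1 + (j.-1 - m)).+1)%N.
Proof. lia. Qed.
End NatDistance.

(** * Heights and growth rates, including the boundary sites *)

Section Height.
Context {n : nat}.
Implicit Types (x : config n) (i : 'I_n).

Lemma heightE x i : height x i.+1 = x i.
Proof. by rewrite /height valK. Qed.

Lemma height_ge x k : (n <= k)%N -> height x k.+1 = 0%N.
Proof. by move=> nk; rewrite /height insubN// -leqNgt. Qed.

(** A missing neighbour counts as height 0, so only genuine neighbours have to be bounded. *)
Lemma height_le_left x i c :
  (forall l : 'I_n, l.+1 = i -> (x l <= c)%N) -> (height x i <= c)%N.
Proof.
case: i => [[|k] kn] //= H; have kn' := ltnW kn.
by rewrite insubT; exact: (H (Ordinal kn') erefl).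
Qed.

Lemma height_le_right x i c :
  (forall l : 'I_n, val l = i.+1 -> (x l <= c)%N) -> (height x i.+2 <= c)%N.
Proof.
move=> H; have [kn|nk] := ltnP i.+1 n; last by rewrite height_ge.
by rewrite -[i.+1]/(val (Ordinal kn)) heightE; apply: H.
Qed.
End Height.

Section GrowthRate.
Context {R : realType} (beta0 beta1 beta2 : R).
Hypotheses (hbeta01 : beta0 < beta1) (hbeta12 : beta1 < beta2).
Local Notation growth_rate := (growth_rate beta0 beta1 beta2).

(** The rate depends on the number of strictly higher neighbours: two, one or none. *)
Lemma growth_rateE a b c : growth_rate a b c =
  if (b < a)%N && (b < c)%N then beta2
  else if (b < a)%N || (b < c)%N then beta1 else beta0.
Proof. by rewrite /growth_rate leq_min leq_max. Qed.

Lemma growth_rate_ge a b c : beta0 <= growth_rate a b c.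
Proof.
have h01 := hbeta01; have h12 := hbeta12; rewrite growth_rateE.
by do 2?[case: ifP => _]; lra.
Qed.

Lemma growth_rate_le a b c : growth_rate a b c <= beta2.
Proof.
have h01 := hbeta01; have h12 := hbeta12; rewrite growth_rateE.
by do 2?[case: ifP => _]; lra.
Qed.

Lemma growth_rate_le1 a b c : (a <= b)%N -> growth_rate a b c <= beta1.
Proof.
have h01 := hbeta01; have h12 := hbeta12; rewrite growth_rateE leqNgt.
by move=> /negbTE ->/=; case: ifP => _; lra.
Qed.

Lemma growth_rate_le0 a b c : (a <= b)%N -> (c <= b)%N ->
  growth_rate a b c <= beta0.
Proof. by rewrite growth_rateE leqNgt => /negbTE -> /=; rewrite leqNgt => /negbTE ->. Qed.

Lemma growth_rate_ge1 a b c : (b < a)%N || (b < c)%N ->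
  beta1 <= growth_rate a b c.
Proof.
have h01 := hbeta01; have h12 := hbeta12; rewrite growth_rateE => ->.
by case: ifP => _; lra.
Qed.
End GrowthRate.

Section LyapunovFunction.
Context {R : realType} (beta0 beta1 beta2 : R) {n : nat}.
Hypotheses (hbeta0 : 0 < beta0) (hbeta01 : beta0 < beta1)
  (hbeta12 : beta1 < beta2) (n_gt0 : (0 < n)%N).
Implicit Types (x : config n) (i j l m : 'I_n) (I : {set 'I_n}).

Definition site_rate x i : R :=
  growth_rate beta0 beta1 beta2 (height x i) (height x i.+1) (height x i.+2).

Lemma site_rate_ge0 x i : 0 <= site_rate x i.
Proof. by rewrite (le_trans _ (growth_rate_ge _ _ _ _ _))// ltW. Qed.

Lemma site_rate_le x i : site_rate x i <= beta2.
Proof. exact: growth_rate_le. Qed.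

(** * Weighted averages over sets of sites *)

Section Weights.
Variable eta : R.
Hypotheses (eta_gt0 : 0 < eta) (eta_le1 : eta <= 1).
Hypothesis eta_small : n%:R * eta * (beta2 - beta1) <= (beta1 - beta0) / 2.

Definition weight i : R := eta ^+ i.
Definition total_weight I : R := \sum_(i in I) weight i.
Definition average I x : R := (\sum_(i in I) weight i * (x i)%:R) / total_weight I.

(** Bounds the ratio of any total weight to any single weight. *)
Let H : R := n%:R / eta ^+ n.

Let weight_gt0 i : 0 < weight i. Proof. exact: exprn_gt0. Qed.
Let weight_le1 i : weight i <= 1. Proof. by rewrite exprn_ile1// ltW. Qed.

Let total_weight_gt0 I m : m \in I -> 0 < total_weight I.
Proof.
move=> mI; rewrite /total_weight (bigD1 m)//= ltr_wpDr// sumr_ge0// => i _.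
exact: ltW.
Qed.

Let H_ge0 : 0 <= H.
Proof. by rewrite /H divr_ge0// exprn_ge0// ltW. Qed.

Let total_weight_le I i : total_weight I <= H * weight i.
Proof.
apply: (@le_trans _ _ n%:R).
  apply: (@le_trans _ _ (\sum_(i in I) 1)); first by apply: ler_sum => l _.
  by rewrite sumr_const ler_nat (leq_trans (max_card _))// card_ord.
rewrite /H mulrAC ler_pdivlMr ?exprn_gt0// ler_wpM2l//.
by apply: ler_wiXn2l => //; [exact: ltW|exact: ltnW].
Qed.

Let weight_sub I x m : m \in I ->
  \sum_(i in I) weight i * ((x i)%:R - average I x) = 0.
Proof.
move=> mI; under eq_bigr do rewrite mulrBr.
rewrite sumrB -mulr_suml -/(total_weight I) mulrC divfK ?subrr//.
by rewrite gt_eqF// (total_weight_gt0 mI).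
Qed.

(* The weights decay geometrically from left to right, so the drift of the
   average is governed by the first site of [I] that is not lower than its right
   neighbour: it grows at rate [beta0], and the sites of [I] before it at rate
   at most [beta1]. *)
Lemma average_drift I x m : m \in I ->
  (forall i l, i \in I -> l \notin I -> l.+1 = i \/ val l = i.+1 ->
     (x l <= x i)%N) ->
  \sum_(i in I) weight i * site_rate x i <=
    (beta1 - (beta1 - beta0) / (2 * H)) * total_weight I.
Proof.
have h01 := hbeta01; have h12 := hbeta12.
move=> mI good.
pose P i := (i \in I) && (height x i.+2 <= x i)%N.
have [k0 Pk0] : exists k, P k.
  (* The rightmost site of [I] qualifies, its right neighbour being outside [I]. *)
  pose k := [arg max_(k > m in I) (k : nat)].
  have [kI kmax] : k \in I /\ forall l, l \in I -> (l <= k)%N.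
    by rewrite /k; case: arg_maxnP.
  exists k; rewrite /P kI/=; apply: height_le_right => l lk.
  apply: (good k l) => //; last by right.
  by apply/negP => /kmax; rewrite lk ltnn.
pose k := [arg min_(k < k0 | P k) (k : nat)].
have [/andP[kI kP] kmin] : P k /\ forall l, P l -> (k <= l)%N.
  by rewrite /k; case: arg_minnP.
(* A left neighbour inside [I] precedes [k], so by minimality of [k] it is lower than its own right
   neighbour; one outside [I] is covered by [good]. *)
have left i : i \in I -> (i <= k)%N -> (height x i <= x i)%N.
  move=> iI ik; apply: height_le_left => l li.
  have [lI|lI] := boolP (l \in I); last by apply: (good i l) => //; left.
  have lk : (l < k)%N by rewrite -li in ik.
  have : ~~ P l by apply/negP => /kmin; rewrite leqNgt lk.
  by rewrite /P lI andTb li heightE -ltnNge => /ltnW.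
(* Site by site: a gain at [k], no loss before [k], and after [k] a loss of at most [beta2 - beta1]
   on a weight smaller by the factor [eta]. *)
have D0 i : i \in I -> weight i * (beta1 - site_rate x i) >=
    (i == k)%:R * (weight k * (beta1 - beta0)) - weight k * eta * (beta2 - beta1).
  move=> iI; have wk := weight_gt0 k.
  have c0 : 0 <= weight k * eta * (beta2 - beta1).
    by rewrite mulr_ge0 ?mulr_ge0 ?(ltW eta_gt0)//; lra.
  have [->|ik] := eqVneq i k.
    have : site_rate x k <= beta0.
      by rewrite /site_rate heightE growth_rate_le0 ?left//.
    move=> rk; have : weight k * (beta1 - beta0) <= weight k * (beta1 - site_rate x k).
      by rewrite ler_wpM2l ?(ltW wk)//; lra.
    rewrite mul1r; lra.
  rewrite mul0r sub0r; case: (ltngtP i k) => [lt|gt|/val_inj]; last first.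
  - by move=> e; rewrite e eqxx in ik.
  - have wi : weight i <= weight k * eta.
      rewrite /weight -exprSr; apply: ler_wiXn2l => //; exact: ltW.
    have r2 := site_rate_le x i.
    have b12 : 0 <= beta2 - beta1 by lra.
    have := ler_wpM2r b12 wi => e1.
    have : weight i * (beta1 - beta2) <= weight i * (beta1 - site_rate x i).
      by rewrite ler_wpM2l ?(ltW (weight_gt0 i))//; lra.
    lra.
  - have r1 : site_rate x i <= beta1.
      by rewrite /site_rate heightE growth_rate_le1// left// ltnW.
    have : 0 <= weight i * (beta1 - site_rate x i).
      by rewrite mulr_ge0 ?(ltW (weight_gt0 i))//; lra.
    lra.
have wk := weight_gt0 k.
have S1 : weight k * (beta1 - beta0) / 2 <= \sum_(i in I) weight i * (beta1 - site_rate x i).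
  apply: (le_trans _ (ler_sum _ D0)).
  rewrite sumrB (bigD1 k)//= eqxx mul1r big1 ?addr0; last first.
    by move=> i /andP[_ /negbTE ->]; rewrite mul0r.
  rewrite sumr_const -mulr_natl.
  have : #|I|%:R * (weight k * eta * (beta2 - beta1)) <= weight k * (n%:R * eta * (beta2 - beta1)).
    rewrite [leRHS](_ : _ = n%:R * (weight k * eta * (beta2 - beta1))); last by ring.
    rewrite ler_wpM2r//; last by rewrite ler_nat (leq_trans (max_card _))// card_ord.
    by rewrite mulr_ge0 ?mulr_ge0 ?(ltW eta_gt0) ?(ltW wk)//; lra.
  have := ler_wpM2l (ltW wk) eta_small; lra.
have nR : 0 < n%:R :> R by rewrite ltr0n.
have H0 : 0 < H by rewrite divr_gt0// exprn_gt0.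
have S2 : (beta1 - beta0) / (2 * H) * total_weight I <= weight k * (beta1 - beta0) / 2.
  have b0 : 0 <= (beta1 - beta0) / (2 * H).
    by apply: divr_ge0; [lra|apply: mulr_ge0 => //; exact: ltW].
  apply: (le_trans (ler_wpM2l b0 (total_weight_le I k))).
  rewrite le_eqVlt; apply/orP; left; apply/eqP; field.
  by rewrite gt_eqF.
move: S1; under eq_bigr do rewrite mulrBr.
rewrite sumrB -mulr_suml -/(total_weight I); lra.
Qed.

(** Weighted deviations from the average sum to 0, so an upper bound [D] on all of them gives a
    lower bound on each, at the cost of the weight ratio [H]. *)
Let average_flat I x D : 0 <= D ->
  (forall i, i \in I -> (x i)%:R <= average I x + D) ->
  forall i, i \in I -> average I x - H * D <= (x i)%:R.
Proof.
move=> D0 xD i iI; have wi := weight_gt0 i.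
have := weight_sub x iI; rewrite (bigD1 i)//=.
set S := \sum_(_ in _ | _) _ => E.
have SW : S <= total_weight I * D.
  rewrite /total_weight (bigD1 i)//= mulrDl mulr_suml.
  apply: (@le_trans _ _ (\sum_(l in I | l != i) weight l * D)).
    apply: ler_sum => l /andP[lI _]; rewrite ler_wpM2l ?(ltW (weight_gt0 l))//.
    by rewrite lerBlDl xD.
  by rewrite lerDr mulr_ge0// ltW.
have := ler_wpM2r D0 (total_weight_le I i) => e1.
have : 0 <= weight i * ((x i)%:R - average I x + H * D) by lra.
by rewrite pmulr_rge0//; lra.
Qed.

Let average_enlarge I x m l D : m \in I -> l \notin I -> 0 <= D ->
  average I x - D <= (x l)%:R -> average I x - D <= average (l |: I) x.
Proof.
move=> mI lI D0 xl; have W0 := total_weight_gt0 mI.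
have W1 : 0 < total_weight (l |: I) by apply: (@total_weight_gt0 _ l); rewrite setU11.
rewrite {2}/average ler_pdivlMr// /total_weight !big_setU1//= -/(total_weight I).
have -> : \sum_(i in I) weight i * (x i)%:R = total_weight I * average I x.
  by rewrite mulrC divfK// gt_eqF.
have := ler_wpM2l (ltW (weight_gt0 l)) xl.
have := mulr_ge0 (ltW W0) D0; lra.
Qed.

Let average_grow I x i m : m \in I ->
  average I (grow x i) = average I x + (i \in I)%:R * weight i / total_weight I.
Proof.
move=> mI; rewrite /average -mulrDl; congr (_ / _).
under eq_bigr => l _ do rewrite ffunE natrD mulrDr.
rewrite big_split/=; congr (_ + _).
have [iI|iI] := boolP (i \in I).
  rewrite (bigD1 i)//= eqxx mulr1 mul1r big1 ?addr0// => l /andP[_ /negbTE ->].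
  by rewrite mulr0.
rewrite mul0r big1// => l lI; case: eqP => [li|_]; last by rewrite mulr0.
by rewrite -li lI in iI.
Qed.

Let average_shift I x x' c m : m \in I ->
  (forall i, (x' i)%:R = (x i)%:R + c :> R) -> average I x' = average I x + c.
Proof.
move=> mI xc; have W0 := total_weight_gt0 mI.
rewrite /average; under eq_bigr do rewrite xc mulrDr.
by rewrite big_split/= -mulr_suml mulrDl -/(total_weight I) mulrAC divff ?mul1r// gt_eqF.
Qed.

(** * The potential of a triple and the comparison of triples *)

Section Potential.
Variable A : R.
Hypothesis A_ge0 : 0 <= A.

(* [level] grows fast enough that adding a higher neighbouring site to a nearly
   flat set [I] increases the potential by at least [A]. *)
Fixpoint level (k : nat) : R :=
  if k is k'.+1 then level k' + (H * (level k' + n.+1%:R * A) + A) else 0.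

(** In [(I, m, j)] the average over [I] is compared with the height at [j]; [m] is a chosen site of
    [I], which keeps [I] nonempty and gives [j] a direction in which to move. *)
Definition triple : finType := ({set 'I_n} * 'I_n * 'I_n)%type.
Implicit Type t : triple.

(** [level] favours large sets and the last term favours a [j] close to [m], so that enlarging [I]
    or moving [j] towards [m] can raise the potential. *)
Definition potential t x : R :=
  average t.1.1 x - (x t.2)%:R + level #|t.1.1|
  - A * (t.1.2 - t.2 + (t.2 - t.1.2))%:R.

Definition valid t : bool := t.1.2 \in t.1.1.

Definition locally_highest I x : Prop :=
  forall i l, i \in I -> l \notin I -> l.+1 = i \/ val l = i.+1 -> (x l <= x i)%N.

Definition potential_bound : R := H * (level n + n.+1%:R * A) + level n.

Let level_step k : level k <= level k.+1.
Proof.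
have level_ge0 : 0 <= level k.
  elim: k => //= k IH; by rewrite addr_ge0 ?addr_ge0// mulr_ge0 ?addr_ge0// mulr_ge0.
by rewrite /= lerDl addr_ge0// mulr_ge0 ?addr_ge0// mulr_ge0.
Qed.

Let level_homo (k k' : nat) : (k <= k')%N -> level k <= level k'.
Proof.
exact: (homo_leq (r := fun u v : R => u <= v) (@lexx _ R) (@le_trans _ R) level_step).
Qed.

Let level_ge0 k : 0 <= level k. Proof. exact: (level_homo (leq0n k)). Qed.

(** If a site of [I] is far above the average, its singleton has a larger potential; if [I] is flat
    and a site next to it is higher, adding that site raises the potential. If [j] lies in the flat
    set [I], the potential is bounded. Otherwise look at the neighbour of [j] towards [m]: either it
    is higher and [j] grows at rate at least [beta1], or [j] moves there. *)
Lemma potential_cases t x : valid t ->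
  [\/ locally_highest t.1.1 x /\ beta1 <= site_rate x t.2,
     exists2 t', valid t' & potential t x + A <= potential t' x
   | potential t x <= potential_bound].
Proof.
case: t => [[I m] j]; rewrite /valid/= => mI.
have A0 := A_ge0; have nA : 0 <= n%:R * A by rewrite mulr_ge0.
have lI := level_ge0 #|I|.
have SnA : n.+1%:R * A = n%:R * A + A by rewrite -natr1 mulrDl mul1r.
(* Passing to a singleton may lose the level of [I] and [n * A] of distance, and must still gain
   [A]. *)
pose D := level #|I| + n.+1%:R * A.
have D0 : 0 <= D by rewrite addr_ge0// mulr_ge0.
have dist_ge0 (u v : 'I_n) : 0 <= A * (u - v + (v - u))%:R by rewrite mulr_ge0.
have [flat|/existsNP[i /not_implyP[iI /negP]]] :=
  pselect (forall i, i \in I -> (x i)%:R <= average I x + D); last first.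
  rewrite -ltNge => xi; apply: Or32; exists ([set i]%SET, i, j); first by rewrite /valid set11.
  rewrite /potential/= /average /total_weight !big_set1 mulrAC divff ?mul1r; last first.
    by rewrite gt_eqF.
  have l1 := level_ge0 #|[set i]%SET|.
  have d1 := dist_ge0 m j.
  have : A * (i - j + (j - i))%:R <= n%:R * A.
    by rewrite mulrC ler_wpM2r// ler_nat dist_le.
  rewrite /D in xi; rewrite /average /total_weight in xi; lra.
have low := average_flat D0 flat.
have HD0 : 0 <= H * D by rewrite mulr_ge0.
have [high|/existsNP[i /existsNP[l /not_implyP[iI /not_implyP[lI' /not_implyP[_ /negP]]]]]] :=
  pselect (locally_highest I x); last first.
  (* The average drops by at most [H * D], which the next [level] returns together with [A]. *)
  rewrite -ltnNge => xil; apply: Or32; exists (l |: I, m, j).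
    by rewrite /valid/= in_setU1 mI orbT.
  rewrite /potential/= cardsU1 lI' add1n /= -/D.
  have xl : average I x - H * D <= (x l)%:R.
    by rewrite (le_trans (low i iI))// ler_nat ltnW.
  have := average_enlarge mI lI' HD0 xl; lra.
have [jI|jI] := boolP (j \in I).
  apply: Or33; rewrite /potential/= /potential_bound.
  have := low j jI; have := dist_ge0 m j.
  have ln : level #|I| <= level n by rewrite level_homo// (leq_trans (max_card _))// card_ord.
  have : H * D <= H * (level n + n.+1%:R * A) by rewrite ler_wpM2l// lerD2r.
  lra.
have jm : val j != val m.
  by apply: contra jI => /eqP/val_inj ->.
have move_to (j' : 'I_n) : ((m - j + (j - m)) = (m - j' + (j' - m)).+1)%N ->
    (x j' <= x j)%N -> exists2 t', valid t' & potential (I, m, j) x + A <= potential t' x.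
  move=> dj xj; exists (I, m, j') => //; rewrite /potential/= dj -natr1 mulrDr mulr1.
  have : (x j')%:R <= (x j)%:R :> R by rewrite ler_nat.
  lra.
have [jlm|mlj] := ltnP j m.
  have j1 : (j.+1 < n)%N by exact: leq_ltn_trans jlm (ltn_ord m).
  have [xj|xj] := ltnP (x j) (x (Ordinal j1)).
    apply: Or31; split => //; apply: growth_rate_ge1 => //.
    by rewrite -[j.+1 in X in _ || X]/(val (Ordinal j1)) !heightE xj orbT.
  by apply: Or32; apply: (move_to (Ordinal j1)) => //; exact: dist_succ.
have mj : (m < j)%N by rewrite ltn_neqAle eq_sym jm.
have jE : j = j.-1.+1 :> nat by rewrite prednK// (leq_trans _ mj).
have j1 : (j.-1 < n)%N by rewrite -jE ltnW.
have [xj|xj] := ltnP (x j) (x (Ordinal j1)).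
  apply: Or31; split => //; apply: growth_rate_ge1 => //.
  by rewrite {2}jE -[j.-1]/(val (Ordinal j1)) !heightE xj.
by apply: Or32; apply: (move_to (Ordinal j1)) => //; exact: dist_pred.
Qed.

(** * Drift of the sum of exponentials *)

Section Exponential.
Variable theta : R.
Hypotheses (theta_gt0 : 0 < theta) (theta_le : theta <= 1 / 2).

Let B : R := n%:R * beta2.
Let eps : R := (beta1 - beta0) / (2 * H).
Hypothesis theta_small : 4 * theta * B <= eps.

Definition term t x : R := expR (theta * potential t x).

Definition lyapunov x : R := \sum_(t | valid t) term t x.

(** The change of the potential of [t] when site [i] grows. *)
Let slope t i : R :=
  (i \in t.1.1)%:R * weight i / total_weight t.1.1 - (i == t.2)%:R.

Let term_grow t x i : valid t ->
  term t (grow x i) = term t x * expR (theta * slope t i).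
Proof.
move=> vt; rewrite /term -expRD -mulrDr; congr (expR (_ * _)).
rewrite /potential (average_grow x i vt) ffunE natrD /slope (eq_sym t.2) ; ring.
Qed.

Let slope_le t i : valid t -> `|slope t i| <= 1.
Proof.
move=> vt; have W0 := total_weight_gt0 vt.
pose u : R := (i \in t.1.1)%:R * weight i / total_weight t.1.1.
have /andP[u0 u1] : 0 <= u <= 1.
  rewrite divr_ge0 ?mulr_ge0 ?(ltW W0) ?(ltW (weight_gt0 i))//=.
  rewrite ler_pdivrMr// mul1r.
  have [iI|_] := boolP (i \in _); last by rewrite mul0r ltW.
  rewrite mul1r /total_weight (bigD1 i)//= lerDl sumr_ge0// => l _; exact: ltW.
rewrite ler_norml (_ : slope t i = u - (i == t.2)%:R)//.
by case: (i == t.2) => /=; rewrite ?subr0; apply/andP; split; lra.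
Qed.

(** Second-order expansion of the exponential: slopes are at most 1 in absolute value and each of
    the [n] rates is at most [beta2], whence the quadratic term. *)
Let term_generator t x : valid t ->
  generator (@grow n) site_rate (term t) x <=
    term t x * (theta * \sum_i site_rate x i * slope t i + 2 * theta ^+ 2 * B).
Proof.
move=> vt; have T0 : 0 < term t x by exact: expR_gt0.
apply: (@le_trans _ _ (term t x * \sum_i (site_rate x i * (theta * slope t i)
    + beta2 * (2 * theta ^+ 2)))).
  rewrite /generator mulr_sumr; apply: ler_sum => i _.
  rewrite (term_grow _ _ vt).
  rewrite (_ : _ * (_ - _) = term t x *
    (site_rate x i * (expR (theta * slope t i) - 1))); last by ring.
  rewrite ler_wpM2l ?(ltW T0)//.
  have sl := slope_le i vt.
  have u1 : `|theta * slope t i| <= 1 / 2.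
    rewrite normrM gtr0_norm//; apply: (le_trans _ theta_le).
    by rewrite ler_piMr// ltW.
  have r0 := site_rate_ge0 x i; have r2 := site_rate_le x i.
  have s2 : (theta * slope t i) ^+ 2 <= theta ^+ 2.
    rewrite exprMn ler_piMr ?sqr_ge0// -real_normK ?num_real//.
    by rewrite exprn_ile1.
  have := expR_le_quadratic u1 => e1.
  have e2 : expR (theta * slope t i) - 1 <= theta * slope t i + 2 * theta ^+ 2 by lra.
  apply: (le_trans (ler_wpM2l r0 e2)); rewrite mulrDr lerD2l.
  by rewrite ler_wpM2r// mulr_ge0// sqr_ge0.
rewrite ler_wpM2l ?(ltW T0)// big_split/= sumr_const card_ord.
rewrite mulr_sumr /B -mulr_natl lerD//; last first.
  rewrite le_eqVlt; apply/orP; left; apply/eqP; ring.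
by apply: ler_sum => i _; rewrite mulrCA.
Qed.

Let B_ge0 : 0 <= B.
Proof.
have h0 := hbeta0; have h1 := hbeta01; have h2 := hbeta12.
rewrite /B mulr_ge0//; lra.
Qed.

Let theta2B : 2 * theta ^+ 2 * B <= theta * eps / 2.
Proof.
have := ler_wpM2l (ltW theta_gt0) theta_small; rewrite expr2; lra.
Qed.

Let term_generator_any t x : valid t ->
  generator (@grow n) site_rate (term t) x <= term t x * B.
Proof.
move=> vt; have T0 : 0 < term t x by exact: expR_gt0.
have th0 := theta_gt0; have th1 := theta_le.
apply: (le_trans (term_generator x vt)); rewrite ler_wpM2l ?(ltW T0)//.
have S : \sum_i site_rate x i * slope t i <= B.
  apply: (@le_trans _ _ (\sum_(i < n) beta2)); last first.
    by rewrite sumr_const card_ord /B mulr_natl.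
  apply: ler_sum => i _; have r0 := site_rate_ge0 x i.
  apply: (le_trans _ (site_rate_le x i)).
  rewrite ler_piMr//; have := slope_le i vt.
  by rewrite ler_norml => /andP[].
have e1 := ler_wpM2l (ltW theta_gt0) S.
have e2 : theta * B <= 1 / 2 * B by rewrite ler_wpM2r.
have e3 : theta * (theta * B) <= theta * (1 / 2 * B) by rewrite ler_wpM2l// ltW.
rewrite expr2; lra.
Qed.

(** The average grows at rate at most [beta1 - eps] and site [t.2] at rate at least [beta1]; by
    [theta_small] half of this decay survives the quadratic term. *)
Let term_generator_good t x : valid t -> locally_highest t.1.1 x ->
  beta1 <= site_rate x t.2 ->
  generator (@grow n) site_rate (term t) x <= - (theta * eps / 2) * term t x.
Proof.
move=> vt high rj; have T0 : 0 < term t x by exact: expR_gt0.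
have th0 := theta_gt0.
apply: (le_trans (term_generator x vt)); rewrite mulrC ler_wpM2r ?(ltW T0)//.
have W0 := total_weight_gt0 vt.
have S : \sum_i site_rate x i * slope t i <= - eps.
  rewrite /slope; under eq_bigr do rewrite mulrBr.
  rewrite sumrB [X in _ - X](bigD1 t.2)//= eqxx mulr1.
  rewrite [X in _ - (_ + X)]big1 ?addr0; last by move=> i /negbTE ->; rewrite mulr0.
  have -> : \sum_i site_rate x i * ((i \in t.1.1)%:R * weight i / total_weight t.1.1) =
      (\sum_(i in t.1.1) weight i * site_rate x i) / total_weight t.1.1.
    rewrite mulr_suml [RHS]big_mkcond/=; apply: eq_bigr => i _.
    case: ifP => _; last by rewrite !mul0r mulr0.
    by rewrite mul1r mulrCA mulrA.
  have := average_drift vt high; rewrite -/eps -ler_pdivrMr// => e1.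
  lra.
have := ler_wpM2l (ltW theta_gt0) S; have := theta2B; lra.
Qed.

(** Good triples decay. By [potential_cases] any other term is bounded or small against the sum, so
    its crude growth rate [B] costs only a constant or an error carrying [expR (- (theta * A))]. *)
Lemma lyapunov_drift x :
  generator (@grow n) site_rate lyapunov x <=
    - (theta * eps / 2) * lyapunov x
    + #|triple|%:R * ((B + theta * eps / 2) *
        (expR (- (theta * A)) * lyapunov x + expR (theta * potential_bound))).
Proof.
have th0 := theta_gt0.
have b10 : 0 <= beta1 - beta0 by have := hbeta01; lra.
set d := theta * eps / 2.
have eps0 : 0 <= eps by apply: divr_ge0 => //; exact: mulr_ge0.
have d0 : 0 <= d by apply: divr_ge0 => //; apply: mulr_ge0 => //; exact: ltW.
have V0 : 0 <= lyapunov x by rewrite sumr_ge0// => t _; exact: expR_ge0.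
set K := (B + d) * _.
have K0 : 0 <= K.
  apply: mulr_ge0; first exact: addr_ge0.
  by apply: addr_ge0; [apply: mulr_ge0 => //; exact: expR_ge0|exact: expR_ge0].
have -> : generator (@grow n) site_rate lyapunov x =
    \sum_(t | valid t) generator (@grow n) site_rate (term t) x.
  rewrite /generator /lyapunov exchange_big/=; apply: eq_bigr => i _.
  by rewrite -sumrB mulr_sumr.
apply: (@le_trans _ _ (\sum_(t | valid t) (- d * term t x + K))); last first.
  rewrite big_split/= -mulr_sumr lerD2l sumr_const -[K *+ _]mulr_natl ler_wpM2r//.
  by rewrite ler_nat max_card.
apply: ler_sum => t vt; have T0 : 0 < term t x by exact: expR_gt0.
have any : term t x <= expR (- (theta * A)) * lyapunov x + expR (theta * potential_bound) ->
    generator (@grow n) site_rate (term t) x <= - d * term t x + K.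
  move=> H1; apply: (le_trans (term_generator_any x vt)).
  have Bd : 0 <= B + d by rewrite addr_ge0.
  have := ler_wpM2l Bd H1; rewrite -/K; lra.
have [[high rj]|[t' vt' le]|bd] := potential_cases x vt.
- by apply: (le_trans (term_generator_good vt high rj)); rewrite lerDl.
- apply: any; apply: (@le_trans _ _ (expR (- (theta * A)) * term t' x)).
    rewrite /term -expRD ler_expR.
    have := ler_wpM2l (ltW th0) le; lra.
  rewrite ler_wpDr ?expR_ge0// ler_wpM2l ?expR_ge0//.
  rewrite /lyapunov (bigD1 t')//= lerDl sumr_ge0// => *; exact: expR_ge0.
- apply: any; rewrite ler_wpDl ?mulr_ge0 ?expR_ge0//.
  by rewrite /term ler_expR ler_wpM2l// ltW.
Qed.

Lemma lyapunov_shift x x' c : (forall i, (x' i)%:R = (x i)%:R + c :> R) ->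
  lyapunov x' = lyapunov x.
Proof.
move=> xc; apply: eq_bigr => t vt; rewrite /term /potential.
rewrite (average_shift vt xc) xc; congr (expR (_ * _)); ring.
Qed.

Lemma lyapunov_ge x i j :
  expR (theta * ((x i)%:R - (x j)%:R - A * n%:R)) <= lyapunov x.
Proof.
have v : valid ([set i]%SET, i, j) by rewrite /valid set11.
apply: (@le_trans _ _ (term ([set i]%SET, i, j) x)); last first.
  rewrite /lyapunov (bigD1 ([set i]%SET, i, j))//= lerDl sumr_ge0// => *; exact: expR_ge0.
rewrite ler_expR ler_wpM2l ?(ltW theta_gt0)// /potential [in leRHS]/= /average /total_weight.
rewrite !big_set1 [X in X - _ + _ - _]mulrAC divff ?mul1r; last by rewrite gt_eqF.
have := level_ge0 #|[set i]%SET|.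
have : A * (i - j + (j - i))%:R <= A * n%:R.
  by rewrite ler_wpM2l// ler_nat dist_le.
lra.
Qed.
End Exponential.
End Potential.
End Weights.

(** The order of choice matters: [eps] is fixed by [eta], so [theta] is chosen without knowing [A],
    and [A] afterwards as large as [theta] demands. *)
Lemma exists_lyapunov : exists V : config n -> R, exists delta C theta c : R,
  [/\ [/\ forall x, 0 <= V x, 0 < delta, 0 <= C, 0 < theta & 0 < c],
    forall x, generator (@grow n) site_rate V x <= - delta * V x + C,
    forall x x' c', (forall i, (x' i)%:R = (x i)%:R + c' :> R) -> V x' = V x
  & forall x i j, expR (theta * ((x i)%:R - (x j)%:R)) <= c * V x].
Proof.
have h0 := hbeta0; have h1 := hbeta01; have h2 := hbeta12.
have nR : 0 < n%:R :> R by rewrite ltr0n.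
pose eta : R := Num.min 1 ((beta1 - beta0) / 2 / (n%:R * (beta2 - beta1))).
have nb : 0 < n%:R * (beta2 - beta1) by rewrite mulr_gt0//; lra.
have eta0 : 0 < eta.
  by rewrite lt_min ltr01 !divr_gt0//; lra.
have eta1 : eta <= 1 by rewrite ge_min lexx.
have etas : n%:R * eta * (beta2 - beta1) <= (beta1 - beta0) / 2.
  by rewrite mulrAC mulrC -ler_pdivlMr// ge_min lexx orbT.
pose H : R := n%:R / eta ^+ n.
have H0 : 0 < H by rewrite divr_gt0// exprn_gt0.
pose B : R := n%:R * beta2.
have B0 : 0 < B by rewrite mulr_gt0//; lra.
pose eps : R := (beta1 - beta0) / (2 * H).
have eps0 : 0 < eps by apply: divr_gt0; [lra|exact: mulr_gt0].
pose theta : R := Num.min (1 / 2) (eps / (4 * B)).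
have th0 : 0 < theta.
  by rewrite lt_min; apply/andP; split; apply: divr_gt0 => //; exact: mulr_gt0.
have th1 : theta <= 1 / 2 by rewrite ge_min lexx.
have ths : 4 * theta * B <= eps.
  have B4 : 0 < 4 * B by exact: mulr_gt0.
  by rewrite mulrAC mulrC -ler_pdivlMr// ge_min lexx orbT.
pose d := theta * eps / 2.
have d0 : 0 < d by apply: divr_gt0 => //; exact: mulr_gt0.
pose N : R := #|triple|%:R * (B + d).
have N0 : 0 <= N by apply: mulr_ge0 => //; apply: addr_ge0; exact: ltW.
(* This makes [expR (theta * A)] at least [1 + 2 * N / d], so the error costs at most half of the
   decay rate [d]. *)
pose A := (2 * N / d) / theta.
have A0 : 0 <= A.
  apply: divr_ge0; last exact: ltW.
  by apply: divr_ge0; [exact: mulr_ge0|exact: ltW].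
have small : N * expR (- (theta * A)) <= d / 2.
  rewrite /A [theta * _]mulrC divfK ?gt_eqF// expRN.
  rewrite ler_pdivrMr ?expR_gt0//.
  apply: (@le_trans _ _ (d / 2 * (1 + 2 * N / d))).
    have -> : d / 2 * (1 + 2 * N / d) = d / 2 + N by field; rewrite gt_eqF.
    by rewrite lerDr divr_ge0// ltW.
  by rewrite ler_wpM2l ?expR_ge1Dx// divr_ge0// ltW.
pose C := N * expR (theta * potential_bound eta A).
exists (lyapunov eta A theta), (d / 2), C, theta, (expR (theta * (A * n%:R))).
split.
- split => //.
  + by move=> x; rewrite sumr_ge0// => t _; exact: expR_ge0.
  + by rewrite divr_gt0.
  + by rewrite mulr_ge0// expR_ge0.
  + exact: expR_gt0.
- move=> x; apply: (le_trans (lyapunov_drift eta0 eta1 etas A0 th0 th1 ths x)).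
  have V0 : 0 <= lyapunov eta A theta x.
    by rewrite sumr_ge0// => t _; exact: expR_ge0.
  rewrite -/eps -/d -/B.
  have := ler_wpM2r V0 small; rewrite /C /N; lra.
- by move=> x x' c' xc; exact: lyapunov_shift xc.
- move=> x i j.
  have := ler_wpM2l (expR_ge0 (theta * (A * n%:R))) (lyapunov_ge eta0 A0 th0 x i j).
  rewrite -expRD; apply: le_trans; rewrite ler_expR; lra.
Qed.
End LyapunovFunction.

(** * The kernel of the differences *)

Section Differences.
Context {n : nat}.
Implicit Types (x : config n) (z : diffs n) (i j : 'I_n).

Lemma height_grow x i k : (k < n)%N ->
  height (grow x i) k.+1 = (height x k.+1 + (k == i))%N.
Proof.
by move=> kn; rewrite -[k]/(val (Ordinal kn)) !heightE ffunE.
Qed.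

Lemma Delta_grow x i (k : 'I_n.-1) :
  Delta (grow x i) k = Delta x k + (k == i :> nat)%:Z - (k.+1 == i)%:Z.
Proof.
have kn : (k.+1 < n)%N by have := ltn_ord k; lia.
rewrite !ffunE !height_grow ?(ltnW kn)//; lia.
Qed.

Lemma Delta_shift x x' : Delta x = Delta x' -> exists c : int,
  forall i, (x' i)%:Z = (x i)%:Z + c.
Proof.
move=> xx; exists ((height x' 1)%:Z - (height x 1)%:Z) => i.
rewrite -!heightE; case: i => k /=; elim: k => [|k IH] kn.
  by rewrite addrC subrK.
have k1 : (k < n.-1)%N by lia.
have := congr1 (fun z : diffs n => z (Ordinal k1)) xx; rewrite !ffunE /=.
have := IH (ltnW kn); lia.
Qed.

(** Subtract the partial sums of [z] from a large constant. This provides a section of [Delta] and,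
    as heights only increase, a reachable configuration with prescribed differences. *)
Lemma exists_Delta_above x z : exists2 x', Delta x' = z & forall i, (x i <= x' i)%N.
Proof.
pose S k : int := \sum_(j < n.-1 | (j < k)%N) z j.
pose c : nat := (\sum_i x i + \sum_(j < n.-1) `|z j|)%N.
have cS i : ((x i)%:Z <= c%:Z - S i).
  have h1 : (x i <= \sum_i x i)%N by rewrite (bigD1 i)//= leq_addr.
  have h2 : S i <= (\sum_(j < n.-1) `|z j|)%N%:Z.
    rewrite /S big_mkcond/= -natz natr_sum/=.
    apply: ler_sum => j _; case: ifP => _; lia.
  rewrite /c; lia.
exists [ffun i : 'I_n => `|c%:Z - S i|%N] => [|i]; last first.
  by rewrite ffunE; have := cS i; lia.
apply/ffunP => k; have kn : (k.+1 < n)%N by have := ltn_ord k; lia.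
rewrite ffunE -[k.+1 in X in _ - X]/(val (Ordinal kn)).
rewrite -[X in height _ X.+1]/(val (Ordinal (ltnW kn))) !heightE !ffunE.
have := cS (Ordinal kn); have := cS (Ordinal (ltnW kn)) => /=.
have -> : S k.+1 = S k + z k.
  rewrite /S (bigD1 k)//= addrC; congr (_ + _); apply: eq_bigl => j.
  by rewrite ltnS -val_eqE/=; lia.
by move=> h1 h2; rewrite !gez0_abs ?(le_trans _ h1) ?(le_trans _ h2)//; ring.
Qed.

End Differences.

Section DifferenceKernel.
Context {R : realType} (beta0 beta1 beta2 : R) {n : nat}.
Hypotheses (hbeta0 : 0 < beta0) (hbeta01 : beta0 < beta1)
  (hbeta12 : beta1 < beta2) (n_gt0 : (0 < n)%N).
Implicit Types (x : config n) (y z : diffs n) (i j : 'I_n).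

Let rate := @site_rate R beta0 beta1 beta2 n.
Let rate_ge0 x i : 0 <= rate x i := site_rate_ge0 hbeta0 hbeta01 hbeta12 x i.
Let lam : R := n%:R * beta2.
Let rate_le x : \sum_i rate x i <= lam.
Proof.
apply: (@le_trans _ _ (\sum_(i < n) beta2)).
  by apply: ler_sum => i _; exact: site_rate_le.
by rewrite sumr_const card_ord /lam mulr_natl.
Qed.

Let lt_shift x x' : Delta x = Delta x' -> forall i j, (x i < x j)%N = (x' i < x' j)%N.
Proof. by move=> /Delta_shift[c xc] i j; have := xc i; have := xc j; lia. Qed.

(** The boundary height 0 is not shifted along with the configuration, but it never exceeds a
    height; so the rates see only comparisons between genuine sites. *)
Lemma site_rate_Delta x x' i : Delta x = Delta x' -> rate x i = rate x' i.
Proof.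
move=> xx; rewrite /rate /site_rate !growth_rateE !heightE.
have left (u : config n) : (u i < height u i)%N =
    if insub i.-1 : option 'I_n is Some l then (0 < i)%N && (u i < u l)%N else false.
  case: insubP => [l _ li|].
    case: (posnP i) => [i0|i0] /=; first by rewrite (_ : height u i = 0%N)// i0.
    by rewrite -(heightE u l) li prednK.
  by have := ltn_ord i; lia.
have right (u : config n) : (u i < height u i.+2)%N =
    if insub i.+1 : option 'I_n is Some l then (u i < u l)%N else false.
  case: insubP => [l _ li|ni]; first by rewrite -li heightE.
  by rewrite height_ge// leqNgt.
rewrite !left !right; case: insubP => [l _ _|_].
  rewrite (lt_shift xx i l).
  by case: insubP => [l' _ _|_] //; rewrite (lt_shift xx i l').
by case: insubP => [l' _ _|_] //; rewrite (lt_shift xx i l').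
Qed.

Lemma Delta_grow_congr x x' i : Delta x = Delta x' -> Delta (grow x i) = Delta (grow x' i).
Proof. by move=> xx; apply/ffunP => k; rewrite !Delta_grow xx. Qed.

Lemma grow_inj x : injective (grow x).
Proof.
move=> i j /ffunP/(_ i); rewrite !ffunE eqxx.
by case: eqP => // _; lia.
Qed.

Lemma grow_neq x i : grow x i != x.
Proof. by apply/eqP => /ffunP/(_ i); rewrite ffunE eqxx; lia. Qed.

Lemma crystal_local_rates p : transition_function p ->
  has_rates p (@crystal_rate R beta0 beta1 beta2 n) ->
  local_rates (@grow n) rate p.
Proof. by apply: has_rates_local => //; [exact: grow_inj|exact: grow_neq]. Qed.

(** Each missing increment uses half of the time that remains; the induction is on a bound for the
    number of increments. *)
Lemma crystal_transition_gt0 p t x x' : transition_function p ->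
  local_rates (@grow n) rate p -> 0 < t -> (forall i, (x i <= x' i)%N) ->
  0 < p t x x'.
Proof.
move=> tf loc; have [k le_k] : exists k, (\sum_i (x' i - x i) <= k)%N by eexists.
elim: k t x le_k => [|k IH] t x le_k t0 xx'.
  have -> : x' = x.
    apply/ffunP => i; apply/eqP; rewrite eqn_leq xx' andbT -subn_eq0 -leqn0.
    by rewrite (leq_trans _ le_k)// (bigD1 i)//= leq_addr.
  by apply: (transition_gt0_refl rate_ge0 rate_le tf loc); exact: ltW.
have [xe|/existsNP[i /eqP xi]] := pselect (forall i, x i = x' i).
  have -> : x' = x by apply/ffunP => i; apply/esym.
  by apply: (transition_gt0_refl rate_ge0 rate_le tf loc); exact: ltW.
have xi' : (x i < x' i)%N by rewrite ltn_neqAle xi xx'.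
have t20 : 0 < t / 2 by rewrite divr_gt0.
rewrite (splitr t).
apply: (transition_gt0_comp tf _ _ (y := grow x i)); rewrite ?(ltW t20)//.
  apply: (transition_gt0_jump rate_ge0 rate_le tf loc) => //; first exact: grow_neq.
  exact: (lt_le_trans hbeta0 (growth_rate_ge hbeta01 hbeta12 _ _ _)).
have gx j : (grow x i j <= x' j)%N.
  by rewrite ffunE; case: eqP => [->|_]; rewrite ?addn1// addn0.
apply: IH => //; rewrite -ltnS (leq_trans _ le_k)// (bigD1 i)//= [X in (_ < X)%N](bigD1 i)//=.
rewrite -addSn leq_add//.
  by rewrite ffunE eqxx addn1 subnSK.
by apply: leq_sum => j _; rewrite leq_sub2l// ffunE leq_addr.
Qed.

Section Kernel.
Variable p0 : R -> config n -> config n -> R.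
Hypotheses (tf0 : transition_function p0) (loc0 : local_rates (@grow n) rate p0).

Let section_of z : config n := projT1 (cid2 (exists_Delta_above [ffun=> 0%N] z)).
Let section_ofK z : Delta (section_of z) = z.
Proof. by rewrite /section_of; case: cid2. Qed.

(** Built from one transition function and one configuration per difference vector; [diff_kernelE]
    shows that neither choice matters. *)
Definition diff_kernel (t : R) z y : R :=
  expect (p0 t) (fun x => (Delta x == y)%:R) (section_of z).

Let unit_ind y : unit_valued (fun x => (Delta x == y)%:R : R).
Proof. by move=> x; rewrite ler0n lern1 leq_b1. Qed.

(** Euler steps preserve functions of [Delta], since rates and jumps are compatible with it;
    [expect_invariant] then exchanges both the transition function and the initial configuration. *)
Lemma diff_kernelE p t x y : transition_function p ->
  local_rates (@grow n) rate p -> 0 <= t ->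
  \esum_(x' in [set x' | Delta x' = y]) (p t x x')%:E = (diff_kernel t (Delta x) y)%:E.
Proof.
move=> tf loc t0; rewrite /diff_kernel.
rewrite -(@expect_invariant _ _ _ (@grow n) rate lam rate_ge0 rate_le
  (fun x x' => Delta x = Delta x') p p0 t (fun x => (Delta x == y)%:R) x)//.
- rewrite (expectE tf)// esum_mkcond; apply: eq_esum => x' _.
  case: eqP => [e|e]; first by rewrite mulr1 mem_set.
  by rewrite mulr0 memNset.
- move=> h f inv u u' uu'; rewrite /euler /generator (inv _ _ uu'); congr (_ + _ * _).
  apply: eq_bigr => i _; rewrite (site_rate_Delta _ uu'); congr (_ * (_ - _)).
  exact/inv/Delta_grow_congr.
- by move=> u u' ->.
Qed.

Lemma diff_kernel_ge0 t z y : 0 <= t -> 0 <= diff_kernel t z y.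
Proof. by move=> t0; have /andP[] := expect_unit_valued tf0 t0 (unit_ind y) (section_of z). Qed.

Let p0_ge0 t x x' : 0 <= t -> (0 <= (p0 t x x')%:E)%E.
Proof. by move=> t0; rewrite lee_fin; case: tf0 => + _ _ _; exact. Qed.

Let k0E t z y : 0 <= t -> (diff_kernel t z y)%:E =
  \esum_(x' in [set x' | Delta x' = y]) (p0 t (section_of z) x')%:E.
Proof. by move=> t0; rewrite diff_kernelE// section_ofK. Qed.

Lemma diff_kernel_sum1 t z : 0 <= t ->
  \esum_(y in [set: diffs n]) (diff_kernel t z y)%:E = 1%E.
Proof.
move=> t0; rewrite (eq_esum (fun y _ => k0E z y t0)).
rewrite -(@esum_fibers _ _ _ (@Delta n)) => [|x]; last exact: p0_ge0.
by case: tf0 => _ -> //.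
Qed.

Lemma diff_kernelD s t z y : 0 <= s -> 0 <= t ->
  (diff_kernel (s + t) z y)%:E =
  \esum_(u in [set: diffs n]) (diff_kernel s z u * diff_kernel t u y)%:E.
Proof.
move=> s0 t0; rewrite k0E ?addr_ge0//.
transitivity (\esum_(x' in [set x' | Delta x' = y]) \esum_(u in [set: config n])
    ((p0 s (section_of z) u)%:E * (p0 t u x')%:E)%E).
  by apply: eq_esum => x' _; case: tf0 => _ _ _ ->.
rewrite esum_exchange; last by move=> x' u; rewrite mule_ge0// p0_ge0.
transitivity (\esum_(u in [set: config n])
    ((p0 s (section_of z) u)%:E * (diff_kernel t (Delta u) y)%:E)%E).
  apply: eq_esum => u _; rewrite esumZl ?p0_ge0// => [|x']; last exact: p0_ge0.
  by rewrite diff_kernelE.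
rewrite (@esum_unfiber _ _ _ (@Delta n) _ (fun v => (diff_kernel t v y)%:E)); last 2 first.
- by move=> u; exact: p0_ge0.
- by move=> v; rewrite lee_fin diff_kernel_ge0.
by apply: eq_esum => v _; rewrite -k0E.
Qed.

Lemma diff_kernel_gt0 t z y : 0 < t -> 0 < diff_kernel t z y.
Proof.
move=> t0; rewrite -lte_fin k0E ?ltW//.
have [x' x'y le_x'] := exists_Delta_above (section_of z) y.
apply: (@lt_le_trans _ _ (p0 t (section_of z) x')%:E).
  by rewrite lte_fin; exact: crystal_transition_gt0.
by apply: (@esum_ge_term _ _ _ (fun x => (p0 t (section_of z) x)%:E)) => // x; rewrite p0_ge0// ltW.
Qed.

Lemma diff_kernel_lyapunov : exists V : diffs n -> R, exists a b theta c : R,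
  [/\ [/\ forall z, 0 <= V z, 0 <= a, a < 1, 0 <= b & 0 < theta],
    0 < c,
    forall z, (\esum_(y in [set: diffs n]) (diff_kernel 1 z y * V y)%:E
      <= (a * V z + b)%:E)%E
  & forall z (k : 'I_n.-1), expR (theta * `|z k|%N%:R) <= c * V z].
Proof.
have [V [delta [C [theta [c [[V0 delta0 C0 theta0 c0] drift shift ge]]]]]] :=
  exists_lyapunov hbeta0 hbeta01 hbeta12 n_gt0.
have VD x x' : Delta x = Delta x' -> V x' = V x.
  move=> /Delta_shift[c' xc]; apply: (shift x x' (c'%:~R)) => i.
  by have := congr1 (fun u : int => u%:~R : R) (xc i); rewrite rmorphD/= !pmulrn.
exists (V \o section_of), (expR (- delta)), (C / delta), theta, c; split => //.
- split => //; rewrite ?expR_ge0 ?divr_ge0 ?(ltW delta0)//; first by move=> z /=.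
  by rewrite expR_lt1 oppr_lt0.
- move=> z /=.
  rewrite (_ : \esum_(y in _) _ = \esum_(x in [set: config n])
     (p0 1 (section_of z) x * V x)%:E).
    have := expect_lyapunov rate_ge0 rate_le V0 delta0 C0 drift (section_of z) tf0 loc0 (@ler01 R).
    by rewrite mulr1.
  transitivity (\esum_(x in [set: config n])
     ((p0 1 (section_of z) x)%:E * (V (section_of (Delta x)))%:E)%E); last first.
    by apply: eq_esum => x _; rewrite -EFinM (VD x)// section_ofK.
  rewrite (@esum_unfiber _ _ _ (@Delta n) _ (fun y => (V (section_of y))%:E)); last 2 first.
  + by move=> u; exact: p0_ge0.
  + by move=> v; rewrite lee_fin.
  by apply: eq_esum => y _; rewrite EFinM k0E.
- move=> z k /=; have kn : (k.+1 < n)%N by have := ltn_ord k; lia.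
  set x := section_of z.
  have zk : z k = (x (Ordinal (ltnW kn)))%:Z - (x (Ordinal kn))%:Z.
    by rewrite -{1}(section_ofK z) ffunE -!heightE.
  have [h|/ltnW h] := leqP (x (Ordinal kn)) (x (Ordinal (ltnW kn))).
    by rewrite zk subzn// absz_nat natrB.
  by rewrite zk -abszN opprB subzn// absz_nat natrB.
Qed.

(** Sublevel sets of [V] are finite, as [V] dominates an exponential of each coordinate, and a
    positive function has a positive lower bound on a finite set. *)
Lemma diff_kernel_small (V : diffs n -> R) (theta c : R) : 0 < theta -> 0 < c ->
  (forall z (k : 'I_n.-1), expR (theta * `|z k|%N%:R) <= c * V z) ->
  forall K y, exists2 e, 0 < e & forall z, V z <= K -> e <= diff_kernel 1 z y.
Proof.
move=> theta0 c0 HV K y.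
(* By [1 + u <= expR u], each coordinate is at most [c * K / theta] on the sublevel set; [dec]
   enumerates the resulting box. *)
pose M := Num.bound (c * K / theta).
pose dec (u : {ffun 'I_n.-1 -> 'I_(M + M).+1}) : diffs n := [ffun k => (u k)%:Z - M%:Z].
have [e e0 He] : exists2 e, 0 < e & forall u, u \in enum {ffun 'I_n.-1 -> 'I_(M + M).+1} ->
    e <= diff_kernel 1 (dec u) y.
  elim: (enum _) => [|u s [e e0 IH]]; first by exists 1.
  exists (Num.min e (diff_kernel 1 (dec u) y)) => [|v].
    by rewrite lt_min e0 diff_kernel_gt0.
  rewrite inE => /predU1P[->|/IH]; first by rewrite ge_min lexx orbT.
  by move=> h; rewrite ge_min h.
exists e => // z VK.
have zM (k : 'I_n.-1) : (`|z k| <= M)%N.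
  have h1 : 1 + theta * `|z k|%N%:R <= c * K.
    by rewrite (le_trans (expR_ge1Dx _))// (le_trans (HV z k))// ler_wpM2l// ltW.
  have cK : 0 <= c * K.
    by apply: le_trans h1; rewrite addr_ge0// mulr_ge0// ltW.
  have h2 : `|z k|%N%:R <= c * K / theta.
    by rewrite ler_pdivlMr// mulrC; lra.
  rewrite -(ler_nat R) (le_trans h2)// ltW// archi_boundP// divr_ge0// ltW//.
pose u : {ffun 'I_n.-1 -> 'I_(M + M).+1} := [ffun k => inord (absz (z k + M%:Z)%R)].
have -> : z = dec u.
  apply/ffunP => k; rewrite !ffunE inordK; have := zM k; lia.
by apply: He; rewrite mem_enum.
Qed.

End Kernel.
End DifferenceKernel.

(** * Skeleton and return times *)

Lemma bigcup_countType_measurable d (T : measurableType d) (S : countType)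
    (F : S -> set T) :
  (forall x, measurable (F x)) -> measurable (\bigcup_x F x).
Proof.
move=> mF; pose G n := if @pickle_inv S n is Some x then F x else set0.
rewrite (_ : \bigcup_x F x = \bigcup_n G n).
  by apply: bigcupT_measurable => n; rewrite /G; case: pickle_inv.
apply/seteqP; split=> w [].
  by move=> x _ Fx; exists (pickle x) => //; rewrite /G pickleK_inv.
by move=> n _; rewrite /G; case: pickle_inv => // x Fx; exists x.
Qed.

Section ImageProcess.
Context {R : realType} {d : measure_display} {T : measurableType d}.
Context {S D : countType} (Delta : S -> D) (X : R -> T -> S).
Hypothesis mX : forall t x, 0 <= t -> measurable [set w | X t w = x].

Definition cylinder (past : seq (R * S)) (s : R) (x : S) : set T :=
  [set w | all (fun u => X u.1 w == u.2) past] `&` [set w | X s w = x].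

(** Constraints at the times [s + h], [s + 2 * h] and so on; nothing is imposed at time [s]. *)
Fixpoint follows (h s : R) (As : seq (set D)) : set T :=
  if As is A :: As' then [set w | A (Delta (X (s + h) w))] `&` follows h (s + h) As'
  else setT.

Lemma image_measurable t (A : set D) : 0 <= t -> measurable [set w | A (Delta (X t w))].
Proof.
move=> t0; pose F x := if `[< A (Delta x) >] then [set w | X t w = x] else set0.
rewrite (_ : [set w | _] = \bigcup_x F x).
  by apply: bigcup_countType_measurable => x; rewrite /F; case: ifP => // _; exact: mX.
apply/seteqP; split=> w /=.
  by move=> Aw; exists (X t w) => //; rewrite /F asboolT.
by move=> [x _]; rewrite /F; case: ifPn => // /asboolP Ax; rewrite /= => ->.
Qed.

Lemma cylinder_measurable past s x : 0 <= s -> all (fun u => 0 <= u.1 <= s) past ->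
  measurable (cylinder past s x).
Proof.
move=> s0 ps; apply: measurableI; last exact: mX.
elim: past ps => [|[u y] past IH] /=.
  by rewrite (_ : [set _ | _] = setT)//; apply/seteqP; split.
move=> /andP[/andP[u0 _] ps].
rewrite (_ : [set _ | _] = [set w | X u w = y] `&`
    [set w | all (fun u => X u.1 w == u.2) past]).
  by apply: measurableI; [exact: mX|exact: IH].
apply/seteqP; split=> w /=; first by move=> /andP[/eqP].
by move=> [-> ->]; rewrite eqxx.
Qed.

Lemma follows_measurable h s As : 0 <= h -> 0 <= s -> measurable (follows h s As).
Proof.
move=> h0; elim: As s => [|A As IH] s s0 //=.
by apply: measurableI; [apply: image_measurable; exact: addr_ge0|apply: IH; exact: addr_ge0].
Qed.

Lemma not_follows h s As w : ~ follows h s As w ->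
  exists2 m, (m < size As)%N & ~ nth setT As m (Delta (X (s + m.+1%:R * h) w)).
Proof.
elim: As s => [|A As IH] s //=.
have [Aw|nAw _] := pselect (A (Delta (X (s + h) w))); last by exists 0%N; rewrite //= mul1r.
move=> nF; have /IH[m ms Hm] : ~ follows h (s + h) As w by move=> F; apply: nF.
by exists m.+1 => //=; rewrite -[m.+2%:R]nat1r mulrDl mul1r addrA.
Qed.

Variables (kappa : R -> D -> D -> R).
Hypothesis kappa_ge0 : forall t z y, 0 <= t -> 0 <= kappa t z y.

Definition path_kernel h (As : seq (set D)) : D -> \bar R :=
  foldr (fun A f => kernel_on (kappa h) A f) (fun=> 1%E) As.

Lemma path_kernel_ge0 h As z : 0 <= h -> (0 <= path_kernel h As z)%E.
Proof.
move=> h0; elim: As z => [|A As IH] z //=.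
by apply: kernel_on_ge0 => // x y; exact: kappa_ge0.
Qed.

Variables (P : probability T R) (p : R -> S -> S -> R).
Hypotheses (tf : transition_function p) (markov : markov_property p P X).
Hypothesis lump : forall t x y, 0 <= t ->
  \esum_(x' in [set x' | Delta x' = y]) (p t x x')%:E = (kappa t (Delta x) y)%:E.

(** The Markov property speaks of exact past states of [X], so each step records the current state
    in [past]; only the sum over next states, grouped by [Delta], passes to [kappa]. *)
Lemma cylinder_follows h past s x As : 0 <= h -> 0 <= s ->
  all (fun u => 0 <= u.1 <= s) past ->
  P (cylinder past s x `&` follows h s As) =
  (P (cylinder past s x) * path_kernel h As (Delta x))%E.
Proof.
move=> h0; elim: As past s x => [|A As IH] past s x s0 ps.
  by rewrite /= setIT mule1.
have p0 y y' : (0 <= (p h y y')%:E)%E by rewrite lee_fin; case: tf => + _ _ _; exact.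
have sh0 : 0 <= s + h by rewrite addr_ge0.
have ps' : all (fun u => 0 <= u.1 <= s + h) ((s, x) :: past).
  rewrite /= s0 lerDl h0 /=; apply: sub_all ps => u /andP[-> us]/=.
  by rewrite (le_trans us)// lerDl.
pose G x' := if `[< A (Delta x') >]
  then cylinder ((s, x) :: past) (s + h) x' `&` follows h (s + h) As else set0.
have -> : cylinder past s x `&` follows h s (A :: As) = \bigcup_x' G x'.
  apply/seteqP; split=> w.
    move=> [[Ew Xw] [Aw Fw]]; exists (X (s + h) w) => //.
    rewrite /G asboolT//; split => //; split => //=.
    by rewrite Xw eqxx.
  move=> [x' _]; rewrite /G; case: ifPn => // /asboolP Ax'.
  move=> [[/= /andP[/eqP Xw Ew] Xw'] Fw]; split; first by split.
  by split => //=; rewrite Xw'.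
rewrite probability_esum; last 2 first.
- move=> x'; rewrite /G; case: ifP => // _; apply: measurableI.
    exact: cylinder_measurable.
  exact: follows_measurable.
- move=> x1 x2 w; rewrite /G; case: ifP => // _ [[_ /= <-] _].
  by case: ifP => // _ [[_ /= <-] _].
have PE x' : P (G x') = (P (cylinder past s x) * ((p h x x')%:E *
    (if `[< A (Delta x') >] then path_kernel h As (Delta x') else 0)))%E.
  rewrite /G; case: ifP => _; last by rewrite measure0 !mule0.
  rewrite IH// muleA; congr (_ * _)%E.
  have := markov (past := past) x x' s0 h0 ps; rewrite /= => <-; congr (P _).
  apply/seteqP; split => w; first by move=> [/= /andP[/eqP Xs aE] Xh].
  by move=> [[aE /= Xs] Xh]; split => //=; rewrite Xs eqxx.
rewrite (eq_esum (fun x' _ => PE x')) esumZl//; last first.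
  by move=> x'; rewrite mule_ge0//; case: ifP => // _; exact: path_kernel_ge0.
congr (_ * _)%E.
rewrite (@esum_unfiber _ _ _ Delta _
  (fun y => if `[< A y >] then path_kernel h As y else 0%E))//; last first.
  by move=> y; case: ifP => // _; exact: path_kernel_ge0.
rewrite /= /kernel_on [RHS]esum_mkcond; apply: eq_esum => y _; rewrite lump//.
have [Ay|nAy] := pselect (A y); first by rewrite asboolT// mem_set.
by rewrite asboolF// memNset// mule0.
Qed.

Variable z : D.
Hypothesis start : P [set w | Delta (X 0 w) = z] = 1%E.

Lemma start_not : P [set w | Delta (X 0 w) <> z] = 0%E.
Proof.
rewrite (_ : [set w | _] = ~` [set w | Delta (X 0 w) = z])//.
rewrite probability_setC ?start ?subee//.
exact: (@image_measurable 0 [set z]).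
Qed.

Lemma probability_follows h As : 0 <= h -> P (follows h 0 As) = path_kernel h As z.
Proof.
move=> h0; have m0 x : measurable (cylinder [::] 0 x) by exact: cylinder_measurable.
have E A : measurable A -> P A = \esum_(x in [set: S]) P (cylinder [::] 0 x `&` A).
  move=> mA; rewrite -probability_esum.
  - congr (P _); apply/seteqP; split=> w; last by move=> [x _ []].
    by move=> Aw; exists (X 0 w).
  - by move=> x; exact: measurableI.
  - by move=> x y w [[_ /= Xx] _] [[_ /= Xy] _]; rewrite -Xx.
rewrite E; last exact: follows_measurable.
transitivity (\esum_(x in [set: S]) (path_kernel h As z * P (cylinder [::] 0 x))%E).
  apply: eq_esum => x _; rewrite cylinder_follows// muleC.
  have [->//|xz] := eqVneq (Delta x) z.
  have -> : P (cylinder [::] 0 x) = 0%E; last by rewrite !mule0.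
  apply/eqP; rewrite eq_le measure_ge0 andbT -start_not.
  apply: le_measure; rewrite ?inE//; last by move=> w [_ /= Xw]; rewrite Xw; exact/eqP.
  exact: (@image_measurable 0 (~` [set z])).
rewrite esumZl//; last exact: path_kernel_ge0.
have := E setT measurableT; rewrite probability_setT.
under eq_esum do rewrite setIT.
by move=> <-; rewrite mule1.
Qed.

Lemma probability_image t y : 0 <= t -> P [set w | Delta (X t w) = y] = (kappa t z y)%:E.
Proof.
move=> t0; have := @probability_follows t [:: [set y]] t0.
rewrite /= setIT add0r => ->; rewrite /kernel_on esum_set1 ?mule1//.
by rewrite lee_fin kappa_ge0.
Qed.

Let avoid := [set y | y != z].

(* Read off the skeleton at integer times: outside this event the process has
   left [z] by time [k] and is at [z] at some integer time in [(k, 2k]]. *)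
Let late (k : nat) : set T := [set w | Delta (X 0 w) <> z] `|`
  (follows 1 0 (nseq k [set z]) `|` follows 1 0 (nseq k setT ++ nseq k avoid)).

Let return_time_le k w : ~ late k w ->
  (return_time (fun t w => Delta (X t w)) z w <= (2 * k%:R)%:E)%E.
Proof.
move=> nl.
have Y0 : Delta (X 0 w) = z by apply: contra_notP nl => ?; left.
have /not_follows[m] : ~ follows 1 0 (nseq k [set z]) w by move=> F; apply: nl; right; left.
rewrite size_nseq => mk; rewrite nth_nseq mk add0r mulr1 => Ym.
have /not_follows[l] : ~ follows 1 0 (nseq k setT ++ nseq k avoid) w.
  by move=> F; apply: nl; right; right.
rewrite size_cat !size_nseq => lk; rewrite nth_cat size_nseq add0r mulr1.
case: ltnP => [lk'|kl]; first by rewrite nth_nseq lk' => /(_ Logic.I).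
rewrite nth_nseq ifT; last by clear -lk kl; lia.
move=> /negP; rewrite negbK => /eqP Yl.
apply: (@le_trans _ _ (l.+1%:R)%:E); last first.
  by rewrite lee_fin -natrM ler_nat; lia.
apply: ereal_inf_lbound; exists l.+1%:R => //; split => //.
apply: (@le_trans _ _ (m.+1%:R)%:E); last by rewrite lee_fin ler_nat; lia.
by apply: ereal_inf_lbound; exists m.+1%:R => //; split => //; rewrite Y0.
Qed.

Let late_measurable k : measurable (late k).
Proof.
apply: measurableU; first exact: (@image_measurable 0 (~` [set z])).
by apply: measurableU; exact: follows_measurable.
Qed.

(** If [k] is the first index at which [late] fails, the return time is at most [2 * k], that is, 2
    for each late index before it. The measure of [late k] decays geometrically. *)
Lemma return_time_integral (r c : R) : 0 <= r -> r < 1 -> 0 <= c ->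
  (forall k, (path_kernel 1 (nseq k [set z]) z +
     path_kernel 1 (nseq k setT ++ nseq k avoid) z <= (r ^+ k * c)%:E)%E) ->
  (\int[P]_w return_time (fun t w => Delta (X t w)) z w < +oo)%E.
Proof.
move=> r0 r1 c0 H.
pose f k w : \bar R := (2%:E * (\1_(late k) w)%:E)%E.
have f0 k w : (0 <= f k w)%E by rewrite mule_ge0// lee_fin.
have ret_ge0 w : (0 <= return_time (fun t w => Delta (X t w)) z w)%E.
  by apply: le_ereal_inf_tmp => _ [t [t0 _ _] <-]; rewrite lee_fin.
have ret_le w : (return_time (fun t w => Delta (X t w)) z w <= \sum_(k <oo) f k w)%E.
  have partial k : (forall j, (j < k)%N -> late j w) ->
      ((2 * k%:R)%:E <= \sum_(k <oo) f k w)%E.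
    move=> Hk; apply: le_trans (nneseries_lim_ge k _) => //.
    rewrite big_mkord (eq_bigr (fun=> 2%:E)) => [|j _]; last first.
      by rewrite /f indicE mem_set ?mule1//; exact: Hk.
    by rewrite sumEFin lee_fin sumr_const card_ord mulr_natr.
  have [[k nk]|all_late] := pselect (exists k, ~ late k w).
    have [k0 /asboolP nk0 k0min] := ex_minnP (ex_intro (fun k => `[< ~ late k w >]) k (asboolT nk)).
    apply: (le_trans (return_time_le nk0)); apply: partial => j jk.
    by apply: contrapT => /asboolT/k0min; rewrite leqNgt jk.
  rewrite (_ : (\sum_(k <oo) f k w)%E = +oo%E) ?leey//.
  apply/eq_infty => y; have := archi_boundP (normr_ge0 y) => yb.
  apply: le_trans (partial (Num.bound `|y|) _).
    by rewrite lee_fin (le_trans (ler_norm _))// (le_trans (ltW yb))// ler_peMl// ler1n.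
  by move=> j _; apply: contrapT => nj; apply: all_late; exists j.
(* The comparison goes through simple functions from below, as the return time has not been shown
   measurable. *)
apply: (@le_lt_trans _ _ (\int[P]_w (\sum_(k <oo) f k w))%E).
  rewrite !ge0_integralTE//; last by move=> w; exact: nneseries_ge0.
  apply: ereal_sup_le => _ [g /= gle <-]; exists g => // w.
  exact: le_trans (gle w) (ret_le w).
have mind k : measurable_fun setT (fun w => (\1_(late k) w)%:E).
  by apply/measurable_EFinP; exact: measurable_indic.
rewrite integral_nneseries//; last by move=> k; exact: measurable_funeM.
apply: (@le_lt_trans _ _ (2 * c / (1 - r))%:E); last by rewrite ltry.
rewrite nneseries_esumT; last by move=> k; exact: integral_ge0.
apply: (le_trans _ (esum_geometric_le r0 r1 (mulr_ge0 (ler0n _ 2) c0))).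
apply: le_esum => k _; rewrite ge0_integralZl_EFin//.
rewrite integral_indic// setIT mulrCA EFinM lee_wpmul2l ?lee_fin//.
apply: (le_trans _ (H k)); rewrite -!probability_follows//.
have m1 := follows_measurable (nseq k [set z]) (@ler01 R) (lexx 0).
have m2 := follows_measurable (nseq k setT ++ nseq k avoid) (@ler01 R) (lexx 0).
have m0 : measurable [set w | Delta (X 0 w) <> z] by exact: (@image_measurable 0 (~` [set z])).
rewrite (le_trans (measureU2 _ m0 (measurableU _ _ m1 m2)))//.
rewrite [X in (X + _)%E](_ : _ = 0%E) ?add0e; last exact: start_not.
exact: measureU2.
Qed.

End ImageProcess.

(** The image of [mu] under [kappa t] is again invariant for [kappa 1], because the two kernels
    commute; uniqueness identifies it with [mu]. *)
Lemma invariant_semigroup {R : realType} {D : countType}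
    (kappa : R -> D -> D -> R) (mu : D -> R) (t : R) :
  (forall s z y, 0 <= s -> 0 <= kappa s z y) ->
  (forall s z, 0 <= s -> \esum_(y in [set: D]) (kappa s z y)%:E = 1%E) ->
  (forall s u z y, 0 <= s -> 0 <= u -> (kappa (s + u) z y)%:E =
     \esum_(v in [set: D]) (kappa s z v * kappa u v y)%:E) ->
  (forall z y, 0 < kappa 1 z y) ->
  (forall z, 0 <= mu z) -> \esum_(z in [set: D]) (mu z)%:E = 1%E ->
  (forall y, \esum_(z in [set: D]) (mu z * kappa 1 z y)%:E = (mu y)%:E) ->
  0 <= t ->
  forall y, \esum_(z in [set: D]) (mu z * kappa t z y)%:E = (mu y)%:E.
Proof.
move=> k0 k1 kD kp mu0 mu1 inv t0.
pose nu y := fine (\esum_(z in [set: D]) (mu z * kappa t z y)%:E).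
have ge0 s z y : 0 <= s -> (0 <= (mu z * kappa s z y)%:E)%E.
  by move=> s0; rewrite lee_fin mulr_ge0// k0.
have sum1 : \esum_(y in [set: D]) \esum_(z in [set: D]) (mu z * kappa t z y)%:E = 1%E.
  rewrite esum_exchange; last by move=> y z; exact: ge0.
  rewrite -mu1; apply: eq_esum => z _; rewrite -[RHS]mule1 -(k1 t z t0).
  by rewrite -esumZl ?lee_fin// => y; rewrite lee_fin k0.
have row0 y : (0 <= \esum_(z in [set: D]) (mu z * kappa t z y)%:E)%E.
  by apply: esum_ge0 => z _; exact: ge0.
have nuE y : (nu y)%:E = \esum_(z in [set: D]) (mu z * kappa t z y)%:E.
  rewrite /nu fineK// ge0_fin_numE//; apply: (@le_lt_trans _ _ 1%E); last by rewrite ltry.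
  by rewrite -sum1; apply: (@esum_ge_term _ _ _
    (fun y => \esum_(z in [set: D]) (mu z * kappa t z y)%:E)).
have comp s u y : 0 <= s -> 0 <= u ->
    \esum_(x in [set: D]) ((\esum_(z in [set: D]) (mu z * kappa s z x)%:E) * (kappa u x y)%:E)%E
    = \esum_(z in [set: D]) (mu z * kappa (s + u) z y)%:E.
  move=> s0 u0.
  transitivity (\esum_(x in [set: D]) \esum_(z in [set: D])
      ((mu z)%:E * (kappa s z x * kappa u x y)%:E)%E).
    apply: eq_esum => x _; rewrite muleC -esumZl ?lee_fin ?k0//; last by move=> z; exact: ge0.
    by apply: eq_esum => z _; rewrite -!EFinM; congr (_%:E); ring.
  rewrite esum_exchange; last first.
    by move=> x z; rewrite mule_ge0// lee_fin// mulr_ge0// k0.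
  apply: eq_esum => z _; rewrite esumZl ?lee_fin//; last first.
    by move=> x; rewrite lee_fin mulr_ge0// k0.
  by rewrite EFinM kD.
suff numu : nu = mu by move=> y; rewrite -nuE numu.
apply: (invariant_unique kp (fun z => k1 1 z ler01)) => //.
- by move=> y; rewrite -lee_fin nuE.
- by rewrite (eq_esum (fun y _ => nuE y)).
- move=> y; rewrite nuE.
  transitivity (\esum_(z in [set: D]) (mu z * kappa (t + 1) z y)%:E).
    by rewrite -comp//; apply: eq_esum => x _; rewrite EFinM nuE.
  rewrite addrC -comp//; apply: eq_esum => x _.
  by rewrite inv EFinM.
Qed.

Lemma path_kernel_cat_nseq {R : realType} {D : countType}
    (kappa : R -> D -> D -> R) (h : R) (A B : set D) (i j : nat) :
  path_kernel kappa h (nseq i A ++ nseq j B) =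
  iter i (kernel_on (kappa h) A) (iter j (kernel_on (kappa h) B) (fun=> 1%E)).
Proof. by elim: i => [|i /= <-//]; elim: j => //= j <-. Qed.

Lemma path_kernel_nseq1 {R : realType} {D : countType}
    (kappa : R -> D -> D -> R) (h : R) (z : D) (k : nat) :
  0 <= kappa h z z ->
  path_kernel kappa h (nseq k [set z]) z = (kappa h z z ^+ k)%:E.
Proof.
move=> k0; elim: k => [|k IH] /=; first by rewrite expr0.
rewrite /kernel_on esum_set1; last by rewrite IH -EFinM lee_fin mulr_ge0// exprn_ge0.
by rewrite IH -EFinM exprS.
Qed.

(** * Recurrence, invariant measure and tails of the differences *)

Theorem theorem1p2 (R : realType) (beta0 beta1 beta2 : R)
    (hbeta0 : 0 < beta0) (hbeta01 : beta0 < beta1) (hbeta12 : beta1 < beta2)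
    (n : nat) (hn : (2 <= n)%N)
    (d : measure_display) (T : measurableType d)
    (P : diffs n -> probability T R) (X : R -> T -> config n)
    (hX : forall z, crystal_growth_process beta0 beta1 beta2 (P z) X)
    (hX0 : forall z, P z [set w | Delta (X 0 w) = z] = 1%E) :
  let DeltaX := fun (t : R) (w : T) => Delta (X t w) in
  positive_recurrent P DeltaX /\
  exists mu : diffs n -> R,
    [/\ invariant_probability P DeltaX mu,
        forall nu, invariant_probability P DeltaX nu -> nu = mu
      & exponential_tails mu].
Proof.
move=> Y; have n0 : (0 < n)%N by exact: ltnW.
have mX t x : 0 <= t -> measurable [set w | X t w = x].
  by case: (hX [ffun=> 0]) => + _ _; exact.
have /choice[p Hp] z : exists p, [/\ transition_function p,
    has_rates p (@crystal_rate R beta0 beta1 beta2 n) & markov_property p (P z) X].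
  by case: (hX z).
have tf z : transition_function (p z) by case: (Hp z).
have loc z : local_rates (@grow n) (@site_rate R beta0 beta1 beta2 n) (p z).
  by case: (Hp z) => tfz rz _; exact: crystal_local_rates.
have mk z : markov_property (p z) (P z) X by case: (Hp z).
pose z0 : diffs n := [ffun=> 0].
(* The transition functions [p z] may a priori differ; the kernel built from [p z0] governs every
   [P z]. *)
pose kappa := diff_kernel (p z0).
have k_ge0 t z y : 0 <= t -> 0 <= kappa t z y := diff_kernel_ge0 (tf z0) z y.
have k_sum1 t z : 0 <= t -> \esum_(y in [set: diffs n]) (kappa t z y)%:E = 1%E.
  exact: (diff_kernel_sum1 hbeta0 hbeta01 hbeta12 n0 (tf z0) (loc z0)).
have k_gt0 z y : 0 < kappa 1 z y.
  exact: (diff_kernel_gt0 hbeta0 hbeta01 hbeta12 n0 (tf z0) (loc z0)).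
have lump z t x y : 0 <= t ->
    \esum_(x' in [set x' | Delta x' = y]) (p z t x x')%:E = (kappa t (Delta x) y)%:E.
  exact: (diff_kernelE hbeta0 hbeta01 hbeta12 n0 (tf z0) (loc z0)).
have law t z y : 0 <= t -> P z [set w | Y t w = y] = (kappa t z y)%:E.
  exact: (probability_image mX k_ge0 (tf z) (mk z) (lump z) (hX0 z)).
have [V [a [b [theta [c [[V0 a0 a1 b0 theta0] c0 drift ge]]]]]] :=
  diff_kernel_lyapunov hbeta0 hbeta01 hbeta12 n0 (tf z0) (loc z0).
have small := diff_kernel_small hbeta0 hbeta01 hbeta12 n0 (tf z0) (loc z0) theta0 c0 ge.
have k_sum1' z := k_sum1 1 z ler01.
split.
- move=> z.
  have [r [c' [r0 r1 c'0 H]]] := taboo_geometric k_gt0 k_sum1' V0 a0 a1 b0 drift small z.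
  (* Another state receives positive mass; it exists because [n] is at least 2. *)
  have kz1 : kappa 1 z z < 1.
    have n1 : (0 < n.-1)%N by rewrite -ltnS prednK.
    pose u : diffs n := [ffun j => z j + 1].
    have uz : z != u.
      by apply/eqP => /ffunP/(_ (Ordinal n1)); rewrite ffunE; lia.
    rewrite -lte_fin -(k_sum1' z) (@esum_split_seq _ _ [:: z; u])//=; last 2 first.
    + by rewrite inE uz.
    + by move=> y; rewrite lee_fin k_ge0.
    rewrite big_cons big_seq1 -addeA lteDl//.
    apply: (@lt_le_trans _ _ (kappa 1 z u)%:E); first by rewrite lte_fin.
    by rewrite leeDl// esum_ge0// => y _; rewrite lee_fin k_ge0.
  pose rho := Num.max (kappa 1 z z) r.
  have rho0 : 0 <= rho by rewrite le_max r0 orbT.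
  apply: (return_time_integral mX k_ge0 (tf z) (mk z) (lump z) (hX0 z)
    (r := rho) (c := 1 + c')) => //.
  + by rewrite gt_max kz1.
  + by rewrite addr_ge0.
  move=> k; rewrite path_kernel_nseq1 ?k_ge0// path_kernel_cat_nseq.
  apply: (le_trans (leeD (lexx _) (H k k))).
  rewrite -EFinD lee_fin mulrDr mulr1 lerD//.
    by rewrite lerXn2r// ?nnegrE ?k_ge0// le_max lexx.
  by rewrite ler_wpM2r// lerXn2r// ?nnegrE// le_max lexx orbT.
have [mu [C [mu0 mu1 mui muV]]] :=
  exists_invariant k_gt0 k_sum1' V0 a0 a1 b0 drift small z0.
exists mu; split.
- split => // t y t0.
  rewrite -(invariant_semigroup k_ge0 k_sum1
    (diff_kernelD hbeta0 hbeta01 hbeta12 n0 (tf z0) (loc z0))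
    k_gt0 mu0 mu1 mui t0 y).
  by apply: eq_esum => z _; rewrite law.
- move=> nu [nu0 nu1 nui]; apply: (invariant_unique k_gt0 k_sum1') => // y.
  by rewrite -(nui 1 y ler01); apply: eq_esum => z _; rewrite law.
- exists (c * `|C| + 1), theta; split => //.
    by rewrite ltr_wpDl// mulr_ge0// ltW.
  move=> k i; set e := expR _; have e0 : 0 <= e by exact: expR_ge0.
  (* Exponential Chebyshev inequality: where the coordinate is at least [k], [e] times its
     exponential is at least 1. *)
  apply: (@le_trans _ _ (\esum_(z in [set: diffs n]) ((c * e)%:E * (mu z * V z)%:E)%E)).
    rewrite esum_mkcond; apply: le_esum => z _; case: ifPn => [|_]; last first.
      by rewrite -EFinM lee_fin !mulr_ge0// ltW.
    rewrite inE /= => kz; rewrite -EFinM lee_fin.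
    have : 1 <= e * (c * V z).
      apply: le_trans (ler_wpM2l e0 (ge z i)).
      rewrite -expRD -[leLHS]expR0 ler_expR addrC subr_ge0 ler_wpM2l ?(ltW theta0)//.
      by rewrite ler_nat.
    move=> /(ler_wpM2l (mu0 z)); rewrite mulr1 => /le_trans; apply.
    by rewrite le_eqVlt; apply/orP; left; apply/eqP; ring.
  have ce0 : 0 <= c * e by rewrite mulr_ge0// ltW.
  rewrite esumZl ?lee_fin//; last by move=> z; rewrite lee_fin mulr_ge0.
  apply: (le_trans (lee_wpmul2l _ muV)); rewrite ?lee_fin//.
  have : c * e * C <= c * e * `|C| by rewrite ler_wpM2l// ler_norm.
  lra.
Qed.
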